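(* Let $i_A:A\to X$ be the embedding of a smooth submanifold and let $k\ge2$. Then the homomorphism $$\widehat H^k(X,A;\mathbb Z)\to\widehat H^k(i_A;\mathbb Z),\qquad h\mapsto h\circ q,$$ where $q:Z_{k-1}(i_A;\mathbb Z)\to Z_{k-1}(X,A;\mathbb Z)$, $q(s,t)=s+\mathrm{im}({i_A}_* )$, commutes with curvature, characteristic class and the inclusion of cohomology classes in $H^{k-1}(X,A;\mathrm{U}(1))$. It provides a 1-1 correspondence of $\widehat H^k(X,A;\mathbb Z)$ with the subgroup of parallel characters in $\widehat H^k(i_A;\mathbb Z)$, i.e. of those characters $h$ with $\mathrm{cov}(h)=0$.
   Context: All chains are smooth singular chains. For a smooth map $\varphi:A\to X$, the mapping cone complex is $C_k(\varphi;\mathbb Z)=C_k(X;\mathbb Z)\times C_{k-1}(A;\mathbb Z)$ with $\partial_\varphi(s,t)=(\partial s+\varphi_*t,-\partial t)$ and cycles $Z_k(\varphi;\mathbb Z)$; $H^k(\varphi;G)$ is the cohomology of the dual complex (differential $\delta_\varphi$). Put $\Omega^k(\varphi)=\Omega^k(X)\times\Omega^{k-1}(A)$, $d_\varphi(\omega,\vartheta)=(d\omega,\varphi^*\omega-d\vartheta)$ and $\int_{(a,b)}(\omega,\vartheta)=\int_a\omega+\int_b\vartheta$. $\widehat H^k(\varphi;\mathbb Z)$ is the group of homomorphisms $h:Z_{k-1}(\varphi;\mathbb Z)\to\mathrm{U}(1)$ for which there is $(\mathrm{curv}(h),\mathrm{cov}(h))\in\Omega^k(\varphi)$ with $h(\partial_\varphi(a,b))=\exp(2\pi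 i\int_{(a,b)}(\mathrm{curv}(h),\mathrm{cov}(h)))$ for all $(a,b)\in C_k(\varphi;\mathbb Z)$; for $k\ge2$ both forms are uniquely determined. The characteristic class $c(h)\in H^k(\varphi;\mathbb Z)$ is the class of the integral cocycle $(\mathrm{curv},\mathrm{cov})(h)-\delta_\varphi\tilde h$, where $\tilde h\in C^{k-1}(\varphi;\mathbb R)$ is any cochain with $h=\exp(2\pi i\tilde h)$ on cycles. $C_*(X,A;\mathbb Z)=C_*(X;\mathbb Z)/{i_A}_*C_*(A;\mathbb Z)$, with cycles $Z_*(X,A;\mathbb Z)$. $\widehat H^k(X,A;\mathbb Z)$ is the group of homomorphisms $h:Z_{k-1}(X,A;\mathbb Z)\to\mathrm{U}(1)$ for which there is $\mathrm{curv}(h)\in\Omega^k(X)$ such that for all $x\in C_k(X,A;\mathbb Z)$ the integral $\int_x\mathrm{curv}(h)$ is well defined (so $i_A^*\mathrm{curv}(h)=0$) and $h(\partial x)=\exp(2\pi i\int_x\mathrm{curv}(h))$. Its characteristic class $c(h)\in H^k(X,A;\mathbb Z)$ is the class of $\mathrm{curv}(h)-\delta\tilde h$ for any $\tilde h\in C^{k-1}(X,A;\mathbb R)$ lifting $h$. Cohomology groups $H^*(X,A;G)$ and $H^*(i_A;G)$ are identified via the chain map $q:C_*(i_A;\mathbb Z)\to C_*(X,A;\mathbb Z)$, $(s,t)\mapsto s+\mathrm{im}({i_A}_* )$. The inclusions of cohomology classes are $j(u)(z)=\langle u,[z]\rangle$ into $\widehat H^k(X,A;\mathbb Z)$ and $j(u)(s,t)=\langle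 u,[s,t]\rangle$ into $\widehat H^k(i_A;\mathbb Z)$. *)

(* Defs.v *)
From HB Require Import structures.
From mathcomp Require Import freeg.
From mathcomp Require Import all_boot all_order all_algebra ring_quotient complex zify.
From mathcomp Require Import all_classical all_reals all_analysis.

Set Implicit Arguments.
Unset Strict Implicit.
Unset Printing Implicit Defensive.

Import Order.TTheory GRing.Theory Num.Theory.
Import numFieldNormedType.Exports.

Local Open Scope classical_set_scope.
Local Open Scope ring_scope.

Section SmoothMaps.
Context {R : realType}.
Implicit Types V W : normedModType R.

(* [Cn n U f]: [f] is of class C^n on the open set [U]. *)
Fixpoint Cn {V W} (n : nat) (U : set V) (f : V -> W) : Prop :=
  if n is n'.+1 then
    (forall x, U x -> differentiable f x) /\
    (forall v, Cn n' U (fun x => 'D_v f x))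
  else forall x, U x -> {for x, continuous f}.

Definition smooth_on {V W} (U : set V) (f : V -> W) := forall n, Cn n U f.

Lemma near_differentiable V W (f g : V -> W) x :
  (\forall y \near x, f y = g y) -> differentiable f x -> differentiable g x.
Proof.
move=> fg df; have [dc /eqaddoP fE] := (diff_locallyP _ _).1 df.
have gE : g \o shift x = cst (g x) + 'd f x +o_ 0 id.
  apply/eqaddoP => e e0; have := fE e e0.
  have fg0 : \forall y \near (0 : V), f (y + x) = g (y + x).
    by have := fg; rewrite [X in X -> _](near_shift 0) /= => H;
       apply: filterS H => y; rewrite /= subr0.
  apply: filterS2 fg0 => y; rewrite !fctE /= => -> ; congr (is_true (`|_ - _| <= _)).
  by rewrite (nbhs_singleton fg).
by apply/diff_locallyP; rewrite (diff_unique dc gE).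
Qed.

Lemma Cn_near V W n (U : set V) (f g : V -> W) :
  open U -> (forall x, U x -> f x = g x) -> Cn n U f -> Cn n U g.
Proof.
move=> oU; elim: n f g => [|n IH] f g fg /=.
  move=> cf x Ux; have fgn : {near nbhs x, f =1 g}.
    by apply: filterS fg _; exact: open_nbhs_nbhs.
  change (g @ x --> g x); rewrite -(fg x Ux).
  by apply: cvg_trans (cf x Ux); apply: near_eq_cvg.
have fgn x : U x -> \forall y \near x, f y = g y.
  by move=> Ux; apply: filterS fg _; exact: open_nbhs_nbhs.
move=> [df cf]; split=> [x Ux|v].
  exact: near_differentiable (fgn x Ux) (df x Ux).
apply: IH (cf v) => x Ux; have [->|v0] := eqVneq v 0; first by rewrite !derive0.
exact: near_eq_derive (fgn x Ux).
Qed.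

Lemma CnW V W n (U : set V) (f : V -> W) : Cn n.+1 U f -> Cn n U f.
Proof.
elim: n f => [|n IH] f [df cf].
  by move=> x Ux; exact: differentiable_continuous (df x Ux).
by split=> // v; exact: IH (cf v).
Qed.

Lemma Cn_continuous V W n (U : set V) (f : V -> W) :
  Cn n U f -> forall x, U x -> {for x, continuous f}.
Proof. by elim: n => [//|n IH] /CnW /IH. Qed.

Lemma Cn_cst V W n (U : set V) (w : W) : open U -> Cn n U (fun=> w).
Proof.
move=> oU; elim: n w => [|n IH] w; first by move=> x _; exact: cvg_cst.
split=> [x _|v]; first exact: differentiable_cst.
by apply: (Cn_near oU _ (IH 0)) => x _; rewrite derive_cst.
Qed.

Lemma CnD V W n (U : set V) (f g : V -> W) : open U ->
  Cn n U f -> Cn n U g -> Cn n U (fun x => f x + g x).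
Proof.
move=> oU; elim: n f g => [|n IH] f g.
  by move=> cf cg x Ux; exact: cvgD (cf x Ux) (cg x Ux).
move=> [df cf] [dg cg]; split=> [x Ux|v].
  by apply: differentiableD; [exact: df|exact: dg].
apply: (Cn_near oU _ (IH _ _ (cf v) (cg v))) => x Ux.
by rewrite -deriveD //; apply: diff_derivable; [exact: df|exact: dg].
Qed.

Lemma Cn_sum V W n (U : set V) m (F : 'I_m -> V -> W) : open U ->
  (forall i, Cn n U (F i)) -> Cn n U (fun x => \sum_i F i x).
Proof.
move=> oU; elim: m F => [|m IH] F cF.
  by apply: (Cn_near oU _ (Cn_cst n 0 oU)) => x _; rewrite big_ord0.
have cS := IH (fun i => F (lift ord0 i)) (fun i => cF _).
by apply: (Cn_near oU _ (CnD oU (cF ord0) cS)) => x _; rewrite big_ord_recl.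
Qed.

Lemma CnM V n (U : set V) (f g : V -> R) : open U ->
  Cn n U f -> Cn n U g -> Cn n U (fun x => f x * g x : R).
Proof.
move=> oU; elim: n f g => [|n IH] f g.
  by move=> cf cg x Ux; exact: cvgM (cf x Ux) (cg x Ux).
move=> cf' cg'; have [df cf] := cf'; have [dg cg] := cg'.
split=> [x Ux|v].
  by apply: (@differentiableM _ _ f g x); [exact: df|exact: dg].
apply: (Cn_near oU _ (CnD oU (IH _ _ (CnW cf') (cg v)) (IH _ _ (CnW cg') (cf v)))).
move=> x Ux; have dfx := diff_derivable (v := v) (df x Ux).
by rewrite (_ : (fun x => _) = f * g) // (deriveM dfx (diff_derivable (v := v) (dg x Ux))).
Qed.

Lemma CnZl V W n (U : set V) (f : V -> R) (w : W) : open U ->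
  Cn n U f -> Cn n U (fun x => f x *: w).
Proof.
move=> oU; elim: n f => [|n IH] f.
  by move=> cf x Ux; exact: cvgZr_tmp (cf x Ux).
move=> [df cf]; split=> [x Ux|v]; first exact: differentiableZl (df x Ux).
apply: (Cn_near oU _ (IH _ (cf v))) => x Ux.
by rewrite (deriveE _ (differentiableZl w (df x Ux))) diffZl ?deriveE //; exact: df.
Qed.

Lemma derive_coord V m (f : V -> 'rV[R]_m) v x i : differentiable f x ->
  'D_v (fun x => f x 0 i) x = ('D_v f x) 0 i.
Proof. by move=> df; rewrite derive_mx ?mxE //; exact: diff_derivable. Qed.

Lemma Cn_coord V m n (U : set V) (f : V -> 'rV[R]_m) i : open U ->
  Cn n U f -> Cn n U (fun x => f x 0 i : R).
Proof.
move=> oU; elim: n f => [|n IH] f.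
  move=> cf x Ux.
  exact: (@continuous_comp _ _ _ f (fun t : 'rV_m => t 0 i) x (cf x Ux)
           (@coord_continuous _ _ _ 0 i _)).
move=> [df cf]; split=> [x Ux|v].
  exact: (differentiable_comp (df x Ux) (differentiable_coord _ _ _)).
apply: (Cn_near oU _ (IH _ (cf v))) => x Ux.
by rewrite derive_coord //; exact: df.
Qed.

Lemma Cn_rV V m n (U : set V) (f : V -> 'rV[R]_m) : open U ->
  (forall i, Cn n U (fun x => f x 0 i : R)) -> Cn n U f.
Proof.
move=> oU cf.
apply: (Cn_near oU _ (Cn_sum oU (fun i => CnZl (delta_mx 0 i) oU (cf i)))) => x _.
by rewrite -row_sum_delta.
Qed.

Lemma Cn_comp V m n (U : set V) (U' : set 'rV[R]_m) (f : V -> 'rV[R]_m)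
    (g : 'rV[R]_m -> R) : open U -> open U' -> (forall x, U x -> U' (f x)) ->
  Cn n U f -> Cn n U' g -> Cn n U (g \o f).
Proof.
move=> oU oU' UU'; elim: n f g UU' => [|n IH] f g UU'.
  by move=> cf cg x Ux; exact: continuous_comp (cf x Ux) (cg _ (UU' x Ux)).
move=> cf' cg'; have [df cf] := cf'; have [dg cg] := cg'.
split=> [x Ux|v].
  by apply: differentiable_comp; [exact: df|exact/dg/UU'].
have cD i := CnM oU (Cn_coord i oU (cf v)) (IH _ _ UU' (CnW cf') (cg (delta_mx 0 i))).
apply: (Cn_near oU _ (Cn_sum oU cD)) => x Ux.
have dfx := df x Ux; have dgx := dg _ (UU' x Ux).
rewrite [RHS]deriveE; last exact: differentiable_comp.
rewrite diff_comp //= -(deriveE v dfx) {2}(row_sum_delta ('D_v f x)).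
rewrite linear_sum /=; apply: eq_bigr => i _.
by rewrite linearZ /= -(deriveE _ dgx).
Qed.

Lemma smooth_on_comp V m p (U : set V) (U' : set 'rV[R]_m) (f : V -> 'rV[R]_m)
    (g : 'rV[R]_m -> 'rV[R]_p) : open U -> open U' -> (forall x, U x -> U' (f x)) ->
  smooth_on U f -> smooth_on U' g -> smooth_on U (g \o f).
Proof.
move=> oU oU' UU' sf sg n; apply: Cn_rV => // i.
have := Cn_comp oU oU' UU' (sf n) (Cn_coord i oU' (sg n)).
by rewrite /comp.
Qed.

Lemma smooth_on_sub V W (U U' : set V) (f : V -> W) :
  U `<=` U' -> smooth_on U' f -> smooth_on U f.
Proof.
move=> UU' sf n; move: (sf n); elim: n f {sf} => [|n IH] f /=.
  by move=> cf x /UU'; exact: cf.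
by case=> df cf; split=> [x /UU'|v]; [exact: df|exact/IH/cf].
Qed.

Lemma smooth_on_coord m i : smooth_on setT (fun t : 'rV[R]_m => t 0 i : R).
Proof.
case=> [|n]; first by move=> x _; exact: coord_continuous.
split=> [x _|v]; first exact: differentiable_coord.
apply: (Cn_near openT _ (Cn_cst n (v 0 i) openT)) => x _.
by rewrite (derive_coord (f := id)) // derive_id.
Qed.

Lemma openIpre (T T' : topologicalType) (U : set T) (U' : set T') (f : T -> T') :
  open U -> open U' -> (forall x, U x -> {for x, continuous f}) ->
  open (U `&` f @^-1` U').
Proof.
rewrite !openE => oU oU' cf x [Ux U'fx].
by apply: filterI; [exact: oU|exact: (cf x Ux) _ (oU' _ U'fx)].
Qed.
End SmoothMaps.

Section Manifolds.
Context {R : realType}.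

(* [cmap] and [cinv] are total functions, meaningful only on the open sets [cdom]
   and [ccod]. *)
Record chart (T : topologicalType) (n : nat) := Chart {
  cdom : set T;
  ccod : set 'rV[R]_n;
  cmap :> T -> 'rV[R]_n;
  cinv : 'rV[R]_n -> T;
  cdom_open : open cdom;
  ccod_open : open ccod;
  cmap_cod : forall p, cdom p -> ccod (cmap p);
  cinv_dom : forall y, ccod y -> cdom (cinv y);
  cmapK : forall p, cdom p -> cinv (cmap p) = p;
  cinvK : forall y, ccod y -> cmap (cinv y) = y;
  cmap_continuous : forall p, cdom p -> {for p, continuous cmap};
  cinv_continuous : forall y, ccod y -> {for y, continuous cinv} }.

(* Finite-dimensional smooth manifolds without boundary, of pure dimension [mdim]
   and possibly empty; the atlas need not be maximal. *)
Record manifold := Manifold {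
  mcarrier :> topologicalType;
  mdim : nat;
  atlas : set (chart mcarrier mdim);
  atlas_cover : forall p, exists2 c, atlas c & cdom c p;
  atlas_smooth : forall c d, atlas c -> atlas d ->
    smooth_on [set y | ccod c y /\ cdom d (cinv c y)] (d \o cinv c);
  manifold_hausdorff : hausdorff_space mcarrier;
  manifold_second_countable : @second_countable mcarrier }.

(* A fixed chart around each point. It identifies T_pM with 'rV_(mdim M): below, a
   row vector attached to [p] holds the coordinates of a tangent vector in the
   chart [chart_at p]. *)
Definition chart_at (M : manifold) (p : M) : chart M (mdim M) :=
  projT1 (cid2 (atlas_cover p)).

Lemma chart_at_atlas (M : manifold) (p : M) : atlas (chart_at p).
Proof. by rewrite /chart_at; case: cid2. Qed.

Lemma chart_at_dom (M : manifold) (p : M) : cdom (chart_at p) p.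
Proof. by rewrite /chart_at; case: cid2. Qed.

Definition smooth_map (M N : manifold) (f : M -> N) :=
  continuous f /\
  forall (c : chart M (mdim M)) (d : chart N (mdim N)), atlas c -> atlas d ->
    smooth_on [set y | ccod c y /\ cdom d (f (cinv c y))] (d \o f \o cinv c).

Record smap (M N : manifold) :=
  Smap { smap_fun :> M -> N; smap_smooth : smooth_map smap_fun }.

Definition tangent_map (M N : manifold) (f : M -> N) (p : M) :
    'rV[R]_(mdim M) -> 'rV[R]_(mdim N) :=
  'd (chart_at (f p) \o f \o cinv (chart_at p)) (chart_at p p).

(* Injective immersion that is a homeomorphism onto its image. *)
Definition embedding (M N : manifold) (f : smap M N) :=
  [/\ injective f,
      (forall p, injective (tangent_map f p)) &
      (forall U : set M, open U -> exists2 V : set N, open V & U = f @^-1` V)].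

End Manifolds.
Arguments manifold : clear implicits.

Section Simplices.
Context {R : realType}.

Definition in_simplex k (t : 'rV[R]_k.+1) : bool :=
  [forall i, 0 <= t 0 i] && (\sum_i t 0 i == 1).

Definition stdsimplex k := {t : 'rV[R]_k.+1 | in_simplex t}.

Lemma vertex_subproof k : in_simplex (delta_mx 0 0 : 'rV[R]_k.+1).
Proof.
apply/andP; split; first by apply/forallP => i; rewrite mxE ler0n.
rewrite (bigD1 ord0) //= big1 ?addr0 ?mxE ?eqxx // => i i0.
by rewrite mxE (negPf i0).
Qed.

Definition vertex0 k : stdsimplex k := exist _ (delta_mx 0 0) (vertex_subproof k).

Definition face_fun k (i : 'I_k.+2) (t : 'rV[R]_k.+1) : 'rV[R]_k.+2 :=
  \row_j (if unlift i j is Some j' then t 0 j' else 0).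

Lemma face_subproof k (i : 'I_k.+2) (t : stdsimplex k) :
  in_simplex (face_fun i (val t)).
Proof.
case: t => t /= /andP[/forallP t0 /eqP t1]; apply/andP; split.
  by apply/forallP => j; rewrite mxE; case: unliftP.
rewrite (bigD1_ord i) //= mxE unlift_none add0r -t1; apply/eqP.
by apply: eq_bigr => j _; rewrite mxE liftK.
Qed.

Definition face k (i : 'I_k.+2) (t : stdsimplex k) : stdsimplex k.+1 :=
  exist _ (face_fun i (val t)) (face_subproof i t).

Lemma face_fun_smooth k (i : 'I_k.+2) U : open U -> smooth_on U (@face_fun k i).
Proof.
move=> oU n; apply: Cn_rV => // j; case jE: (unlift i j) => [j'|].
  apply: (Cn_near oU _ (smooth_on_sub (@subsetT _ _) (smooth_on_coord j') n)).
  by move=> t _; rewrite mxE jE.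
by apply: (Cn_near oU _ (Cn_cst n 0 oU)) => t _; rewrite mxE jE.
Qed.

(* Smoothness on the closed simplex: locally the restriction of a smooth map defined
   on an open subset of R^(k+1). *)
Definition smooth_simplex (M : manifold R) k (s : stdsimplex k -> M) :=
  forall t : stdsimplex k, exists U (c : chart M (mdim M)) (g : 'rV[R]_k.+1 -> 'rV[R]_(mdim M)),
    [/\ open U, U (val t), atlas c, smooth_on U g &
        forall t' : stdsimplex k, U (val t') -> cdom c (s t') /\ c (s t') = g (val t')].

Record ssimplex (M : manifold R) k := SSimplex {
  simplex_fun :> stdsimplex k -> M;
  simplex_smooth : smooth_simplex simplex_fun }.

HB.instance Definition _ M k := gen_eqMixin (ssimplex M k).
HB.instance Definition _ M k := gen_choiceMixin (ssimplex M k).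

Lemma ssimplex_ext (M : manifold R) k (s s' : ssimplex M k) :
  (forall t, s t = s' t) -> s = s'.
Proof.
case: s => f sf; case: s' => f' sf' /= /funext ff'.
by case: _ / ff' in sf' *; congr SSimplex; exact: Prop_irrelevance.
Qed.

Lemma face_simplex_subproof (M : manifold R) k (s : ssimplex M k.+1) i :
  smooth_simplex (s \o face i).
Proof.
move=> t; have [U [c [g [oU Ut ac sg gE]]]] := simplex_smooth s (face i t).
have cf x : {for x, continuous (@face_fun k i)}.
  exact: (face_fun_smooth i openT 0).
have oU' : open (setT `&` @face_fun k i @^-1` U) by exact: openIpre openT oU _.
exists (setT `&` @face_fun k i @^-1` U), c, (g \o face_fun i); split=> //.
  apply: (smooth_on_comp oU' oU _ _ sg); first by move=> x [].
  exact: face_fun_smooth.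
by move=> t' [_ Ut']; exact: gE.
Qed.

Definition face_simplex (M : manifold R) k (s : ssimplex M k.+1) (i : 'I_k.+2) :=
  SSimplex (@face_simplex_subproof M k s i).

Lemma push_simplex_subproof (M N : manifold R) (f : smap M N) k
  (s : ssimplex M k) : smooth_simplex (f \o s).
Proof.
move=> t; have [U [c [g [oU Ut ac sg gE]]]] := simplex_smooth s t.
have [cf sf] := smap_smooth f.
pose d := chart_at (f (s t)); have ad : atlas d := chart_at_atlas _.
pose V := ccod c `&` (f \o cinv c) @^-1` cdom d.
have oV : open V.
  have cc y : ccod c y -> {for y, continuous (f \o cinv c)}.
    by move=> cy; exact: continuous_comp (cinv_continuous cy) (cf _).
  exact: (openIpre (@ccod_open _ _ _ c) (@cdom_open _ _ _ d) cc).
have oU' : open (U `&` g @^-1` V).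
  exact: openIpre oU oV (Cn_continuous (sg 0)).
have sVE t' : U (val t') -> g (val t') = c (s t') /\ cinv c (g (val t')) = s t'.
  by move=> /gE[cs <-]; rewrite cmapK.
exists (U `&` g @^-1` V), d, (d \o f \o cinv c \o g); split=> //.
- split=> //; have [gt sgt] := sVE _ Ut; split; rewrite /= ?sgt.
    by rewrite gt; apply: cmap_cod; case: (gE _ Ut).
  exact: chart_at_dom.
- apply: (smooth_on_comp oU' oV _ _ (sf c d ac ad)); first by move=> x [].
  by apply: smooth_on_sub sg; exact: subIsetl.
- by move=> t' [/sVE[gt sgt]] [_] /=; rewrite sgt.
Qed.

Definition push_simplex (M N : manifold R) (f : smap M N) k (s : ssimplex M k) :=
  SSimplex (@push_simplex_subproof M N f k s).

End Simplices.
Arguments stdsimplex : clear implicits.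

Section FreeAbelianGroups.
Variables (K : choiceType) (V : zmodType).

(* The Z-linear extension of [f]; [zmodule V] is [V] seen as a Z-module. *)
Definition zlift (f : K -> V) : {freeg K / int} -> V :=
  fglift (f : K -> zmodule V).

Lemma zlift_zmod_morphism f : zmod_morphism (zlift f).
Proof. exact: (@lift_is_additive int K (zmodule V) f). Qed.

HB.instance Definition _ f :=
  GRing.isZmodMorphism.Build {freeg K / int} V (zlift f) (zlift_zmod_morphism f).

Lemma zliftU f x : zlift f << x >> = f x.
Proof. by rewrite /zlift liftU scale1r. Qed.

Lemma freeg_additive_ext (f g : {additive {freeg K / int} -> V}) :
  (forall x, f << x >> = g << x >>) -> f =1 g.
Proof.
move=> fg D; rewrite -(freeg_sumE D) !raddf_sum; apply: eq_bigr => x _ /=.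
have -> : << coeff x D *g x >> = << x >> *~ coeff x D :> {freeg K / int}.
  by rewrite freegU_mulz intz.
by rewrite !raddfMz fg.
Qed.

End FreeAbelianGroups.

Section SingularChains.
Context {R : realType}.

Definition chains (M : manifold R) k := {freeg (ssimplex M k) / int}.

(* Complexes are graded by [nat] with boundary C_k -> C_(k.-1), zero for k = 0. *)
Definition sing_bd (M : manifold R) k : {additive chains M k -> chains M k.-1} :=
  match k with
  | 0%N => \0
  | k'.+1 => zlift (fun s : ssimplex M k'.+1 =>
      \sum_(i < k'.+2) << (-1) ^+ i *g face_simplex s i >>)
  end.

Definition push_chain (M N : manifold R) (f : smap M N) k :
    {additive chains M k -> chains N k} :=
  zlift (fun s : ssimplex M k => << push_simplex f s >>).

Lemma face_face k (i l : 'I_k.+3) (j j' : 'I_k.+2) (t : stdsimplex R k) :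
  l = lift i j -> i = lift l j' -> face i (face j t) = face l (face j' t).
Proof.
move=> lE iE; have ij : (i : nat) = bump l j' by rewrite iE.
have lj : (l : nat) = bump i j by rewrite lE.
have j'E : (j' : nat) = unbump j i by rewrite ij [in LHS](_ : (j' : nat) = unbump l i) ?ij ?bumpK // lj /bump /unbump; lia.
have C m' : lift i (lift j m') = lift l (lift j' m').
  by apply: val_inj; rewrite /= bumpC -lj -j'E.
apply: val_inj; apply/rowP => m; rewrite /= !mxE.
case: (unliftP i m) => [a|] mE; last first.
  by rewrite mE iE liftK mxE unlift_none.
rewrite mxE; case: (unliftP j a) => [b|] aE; last first.
  by rewrite mE aE -lE unlift_none.
by rewrite mE aE C liftK mxE liftK.
Qed.

Lemma sing_bd_simplex (M : manifold R) k (s : ssimplex M k.+1) :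
  sing_bd M k.+1 << s >> = \sum_(i < k.+2) << (-1) ^+ i *g face_simplex s i >>.
Proof. exact: zliftU. Qed.

Lemma freegZ (K : choiceType) (c : int) (x : K) :
  << c *g x >> = << x >> *~ c :> {freeg K / int}.
Proof. by rewrite freegU_mulz intz. Qed.

Lemma sing_bdK (M : manifold R) k (x : chains M k) :
  sing_bd M k.-1 (sing_bd M k x) = 0.
Proof.
case: k x => [|[|k]] x //.
pose f := sing_bd M k.+1 \o sing_bd M k.+2 : {additive chains M k.+2 -> chains M k}.
apply: (@freeg_additive_ext _ _ f \0) => s; rewrite /f [LHS]/=; transitivity (0 : chains M k) => //.
pose F (i : 'I_k.+3) (l : 'I_k.+3) : chains M k :=
  if unlift i l is Some j then
    << (-1) ^+ (i + j) *g face_simplex (face_simplex s i) j >> else 0.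
transitivity (\sum_i \sum_l F i l).
  rewrite sing_bd_simplex raddf_sum; apply: eq_bigr => i _.
  rewrite freegZ raddfMz sing_bd_simplex (bigD1_ord i) //= {1}/F unlift_none add0r.
  rewrite mulrz_suml; apply: eq_bigr => j _.
  by rewrite /F liftK freeg_mulz mulrzz -exprD addnC.
have Fanti (i l : 'I_k.+3) : (i < l)%N -> F l i = - F i l.
  move=> il; rewrite /F.
  case: (unliftP i l) => [j lE|lE]; last by rewrite lE ltnn in il.
  case: (unliftP l i) => [j' iE|iE]; last by rewrite iE ltnn in il.
  rewrite freegUN; congr << _ *g _ >>.
    have [ij lj] : (i : nat) = bump l j' /\ (l : nat) = bump i j.
      by split; [rewrite {1}iE|rewrite {1}lE].
    have -> : (i = j' :> nat)%N by move: ij il; rewrite /bump; lia.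
    have -> : (l = j.+1 :> nat)%N by move: lj il; rewrite /bump; lia.
    by rewrite addSn exprS mulN1r addnC.
  apply: ssimplex_ext => t /=; congr (s _); exact: face_face iE lE.
have FD i : \sum_l F i l = \sum_(l < k.+3 | (i < l)%N) F i l + \sum_(l < k.+3 | (l < i)%N) F i l.
  rewrite (bigD1 i) //= {1}/F unlift_none add0r (bigID (fun l : 'I_k.+3 => (i < l)%N)) /=.
  congr (_ + _); apply: eq_bigl => l; rewrite -val_eqE /=; case: ltngtP => //.
under eq_bigr do rewrite FD.
rewrite big_split /= [X in _ + X](exchange_big_dep xpredT) //= -big_split /=.
apply: big1 => i _; rewrite -big_split /=; apply: big1 => l il.
by rewrite (Fanti i l il) subrr.
Qed.

Lemma push_chain_bd (M N : manifold R) (f : smap M N) k (x : chains M k) :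
  push_chain f k.-1 (sing_bd M k x) = sing_bd N k (push_chain f k x).
Proof.
case: k x => [|k] x /=; first exact: raddf0.
pose g := push_chain f k \o sing_bd M k.+1 : {additive chains M k.+1 -> chains N k}.
pose g' := sing_bd N k.+1 \o push_chain f k.+1 : {additive chains M k.+1 -> chains N k}.
apply: (@freeg_additive_ext _ _ g g') => s; rewrite /g /g' [LHS]/= [RHS]/=.
rewrite sing_bd_simplex raddf_sum [X in sing_bd _ _ X]zliftU sing_bd_simplex.
apply: eq_bigr => i _; rewrite freegZ raddfMz [X in X *~ _]zliftU -freegZ.
by congr << _ *g _ >>; exact: ssimplex_ext.
Qed.

End SingularChains.

Section Forms.
Context {R : realType}.

(* A k-form assigns to [p] an alternating multilinear map on T_pM, expressed in the
   chart [chart_at p]. In an arbitrary chart [c] of the atlas, the constant vector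
   [v i] at [y] has coordinates ['d (chart_at p \o cinv c) y (v i)] at
   [p = cinv c y]. *)
Record form (M : manifold R) (k : nat) := Form {
  form_fun :> M -> ('I_k -> 'rV[R]_(mdim M)) -> R;
  form_linear : forall p (v : 'I_k -> 'rV[R]_(mdim M)) i a u w,
    form_fun p (dfwith v i (a *: u + w)) =
      a * form_fun p (dfwith v i u) + form_fun p (dfwith v i w);
  form_alternating : forall p (v : 'I_k -> 'rV[R]_(mdim M)) i j,
    i != j -> v i = v j -> form_fun p v = 0;
  form_smooth : forall (c : chart M (mdim M)) (v : 'I_k -> 'rV[R]_(mdim M)),
    atlas c ->
    smooth_on (ccod c) (fun y => form_fun (cinv c y)
      (fun i => 'd (chart_at (cinv c y) \o cinv c) y (v i))) }.

HB.instance Definition _ M k := gen_eqMixin (form M k).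
HB.instance Definition _ M k := gen_choiceMixin (form M k).

Lemma form0_subproof (M : manifold R) (c : chart M (mdim M)) :
  smooth_on (ccod c) (fun=> 0 : R).
Proof. by move=> n; apply: Cn_cst; exact: ccod_open. Qed.

Definition form0 (M : manifold R) k : form M k.
Proof.
refine (@Form M k (fun _ _ => 0) _ _ _).
- by move=> *; rewrite mulr0 addr0.
- by [].
- by move=> c v _; exact: form0_subproof.
Defined.

(* [corner] parametrizes the standard simplex by {x | x_i >= 0, sum x_i <= 1}, which
   fixes the orientation. The density of [w] pulled back along [s] is taken on the
   interior, where derivatives do not depend on the totalisation by [insubd], and
   is extended by zero; the boundary has measure zero. *)
Definition corner k (x : 'rV[R]_k) : 'rV[R]_k.+1 :=
  row_mx (1 - \sum_i x 0 i)%:M x.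

Definition simplex_param (M : manifold R) k (s : ssimplex M k) (x : 'rV[R]_k) : M :=
  s (insubd (vertex0 k) (corner x)).

Definition simplex_density (M : manifold R) k (w : form M k) (s : ssimplex M k)
    (x : 'rV[R]_k) : R :=
  if [forall i, 0 < x 0 i] && (\sum_i x 0 i < 1) then
    let p := simplex_param s x in
    w p (fun i => 'D_(delta_mx 0 i) (chart_at p \o simplex_param s) x)
  else 0.

Fixpoint iterated_integral k : ('rV[R]_k -> R) -> R :=
  match k with
  | 0%N => fun f => f 0
  | k'.+1 => fun f => \int[lebesgue_measure]_x
      iterated_integral (fun y : 'rV[R]_k' => f (row_mx x%:M y))
  end.

Definition integral (M : manifold R) k (w : form M k) : {additive chains M k -> R} :=
  zlift (fun s : ssimplex M k => iterated_integral (simplex_density w s)).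

End Forms.

Section CircleGroup.
Variable R : realType.

Record U1 := MkU1 { U1val : R[i]; U1P : `|U1val| == 1 }.

HB.instance Definition _ := [isSub for U1val].
HB.instance Definition _ := [Choice of U1 by <:].

Let one_subproof : `|1 : R[i]| == 1. Proof. by rewrite normr1. Qed.
Let mul_subproof (z w : U1) : `|val z * val w| == 1.
Proof. by rewrite normrM (eqP (U1P z)) (eqP (U1P w)) mulr1. Qed.
Let inv_subproof (z : U1) : `|(val z)^-1| == 1.
Proof. by rewrite normfV (eqP (U1P z)) invr1. Qed.

(* U(1) is written additively, as are all abelian groups of coefficients. *)
Definition U1one := MkU1 one_subproof.
Definition U1mul z w := MkU1 (mul_subproof z w).
Definition U1inv z := MkU1 (inv_subproof z).

Lemma U1mulA : associative U1mul.
Proof. by move=> x y z; apply: val_inj; exact: mulrA. Qed.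
Lemma U1mulC : commutative U1mul.
Proof. by move=> x y; apply: val_inj; exact: mulrC. Qed.
Lemma U1mul1 : left_id U1one U1mul.
Proof. by move=> x; apply: val_inj; exact: mul1r. Qed.
Lemma U1mulV : left_inverse U1one U1inv U1mul.
Proof.
move=> x; apply: val_inj; apply: mulVf.
by rewrite -normr_eq0 (eqP (U1P x)) oner_neq0.
Qed.

HB.instance Definition _ := GRing.isZmodule.Build U1 U1mulA U1mulC U1mul1 U1mulV.

Lemma expi_subproof (x : R) : `|cos x +i* sin x|%C == 1.
Proof. by rewrite normc_def /= cos2Dsin2 sqrtr1. Qed.

Definition exp2pii (x : R) : U1 := MkU1 (expi_subproof (2 * pi * x)).

End CircleGroup.


Definition hom (U V : zmodType) : Type := {additive U -> V}.
HB.instance Definition _ U V := gen_eqMixin (hom U V).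
HB.instance Definition _ U V := gen_choiceMixin (hom U V).

Lemma additive_ext (U V : zmodType) (f g : {additive U -> V}) : f =1 g -> f = g.
Proof.
case: f => f [[f0]]; case: g => g [[g0]] /= /funext fg; subst g.
by rewrite (Prop_irrelevance f0 g0).
Qed.

Section HomGroup.
Variables U V : zmodType.
Definition hom_zero : hom U V := (\0 : {additive U -> V}).
Definition hom_add (f g : hom U V) : hom U V := (f \+ g : {additive U -> V}).
Definition hom_opp (f : hom U V) : hom U V := (\- f : {additive U -> V}).

Lemma hom_addA : associative hom_add.
Proof. by move=> f g h; apply: additive_ext => x /=; rewrite addrA. Qed.
Lemma hom_addC : commutative hom_add.
Proof. by move=> f g; apply: additive_ext => x /=; rewrite addrC. Qed.
Lemma hom_add0 : left_id hom_zero hom_add.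
Proof. by move=> f; apply: additive_ext => x /=; rewrite add0r. Qed.
Lemma hom_addN : left_inverse hom_zero hom_opp hom_add.
Proof. by move=> f; apply: additive_ext => x /=; rewrite addNr. Qed.

HB.instance Definition _ :=
  GRing.isZmodule.Build (hom U V) hom_addA hom_addC hom_add0 hom_addN.
End HomGroup.

Definition hom_comp (U V W : zmodType) (g : hom V W) (f : {additive U -> V}) :
  hom U W := (g \o f : {additive U -> W}).

Record chain_complex := ChainComplex {
  ch :> nat -> zmodType;
  bd : forall k, {additive ch k -> ch k.-1};
  bd0 : forall x, bd 0 x = 0;
  bdK : forall k x, bd k.-1 (bd k x) = 0 }.
Arguments bd {c} k.

Record chain_map (C D : chain_complex) := ChainMap {
  cm : forall k, {additive C k -> D k};
  cm_bd : forall k x, cm k.-1 (bd k x) = bd k (cm k x) }.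

Section Cycles.
Variables (C : chain_complex) (k : nat).

Definition is_cycle : {pred C k} := [pred z | bd k z == 0].
Lemma is_cycle_closed : zmod_closed is_cycle.
Proof.
by split=> [|x y]; rewrite !inE ?raddf0 // => /eqP x0 /eqP y0;
   rewrite raddfB x0 y0 subrr.
Qed.
HB.instance Definition _ := GRing.isZmodClosed.Build (C k) is_cycle is_cycle_closed.

Record cycle := Cycle { cycle_val : C k; _ : cycle_val \in is_cycle }.
HB.instance Definition _ := [isSub for cycle_val].
HB.instance Definition _ := [Choice of cycle by <:].
HB.instance Definition _ := [SubChoice_isSubZmodule of cycle by <:].
End Cycles.

Lemma bd_cycle_subproof (C : chain_complex) k (x : C k) : bd k x \in is_cycle (k := k.-1).
Proof. by rewrite inE bdK eqxx. Qed.

Definition bd_cycle (C : chain_complex) k (x : C k) : cycle C k.-1 :=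
  Cycle (bd_cycle_subproof x).

Section CycleMap.
Variables (C D : chain_complex) (f : chain_map C D) (k : nat).

Lemma cycle_map_subproof (z : cycle C k) : cm f k (val z) \in is_cycle (k := k).
Proof. by case: z => z /= z0; rewrite inE -cm_bd (eqP z0) raddf0 eqxx. Qed.

Definition cycle_map (z : cycle C k) : cycle D k := Cycle (cycle_map_subproof z).

Lemma cycle_map_zmod_morphism : zmod_morphism cycle_map.
Proof. by move=> x y; apply: val_inj; rewrite /= !raddfB. Qed.
HB.instance Definition _ := GRing.isZmodMorphism.Build (cycle C k) (cycle D k)
  cycle_map cycle_map_zmod_morphism.
End CycleMap.

Section Cohomology.
Variables (C : chain_complex) (G : zmodType) (k : nat).

Definition is_cocycle : {pred hom (C k) G} :=
  [pred f : hom (C k) G | `[< forall x : C k.+1, f (bd k.+1 x) = 0 >] ].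
Lemma is_cocycleP (f : hom (C k) G) :
  reflect (forall x : C k.+1, f (bd k.+1 x) = 0) (f \in is_cocycle).
Proof. exact: asboolP. Qed.
Lemma is_cocycle_closed : zmod_closed is_cocycle.
Proof.
split=> [|f g]; first exact/is_cocycleP.
move=> /is_cocycleP f0 /is_cocycleP g0; apply/is_cocycleP => x.
by transitivity (f (bd k.+1 x) - g (bd k.+1 x)); rewrite // f0 g0 subrr.
Qed.
HB.instance Definition _ :=
  GRing.isZmodClosed.Build (hom (C k) G) is_cocycle is_cocycle_closed.

Record cocycle := Cocycle { cocycle_val : hom (C k) G; _ : cocycle_val \in is_cocycle }.
HB.instance Definition _ := [isSub for cocycle_val].
HB.instance Definition _ := [Choice of cocycle by <:].
HB.instance Definition _ := [SubChoice_isSubZmodule of cocycle by <:].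

Definition is_coboundary : {pred cocycle} :=
  [pred f : cocycle | `[< exists g : hom (C k.-1) G, forall x, val f x = g (bd k x) >] ].
Lemma is_coboundaryP (f : cocycle) :
  reflect (exists g : hom (C k.-1) G, forall x, val f x = g (bd k x))
          (f \in is_coboundary).
Proof. exact: asboolP. Qed.
Lemma is_coboundary_closed : zmod_closed is_coboundary.
Proof.
split=> [|f g]; first by apply/is_coboundaryP; exists 0.
move=> /is_coboundaryP[f' fE] /is_coboundaryP[g' gE]; apply/is_coboundaryP.
by exists (f' - g') => x; transitivity (val f x - val g x); rewrite // fE gE.
Qed.
HB.instance Definition _ :=
  GRing.isZmodClosed.Build cocycle is_coboundary is_coboundary_closed.

Definition cohomology := Quotient.quot is_coboundary.
HB.instance Definition _ := GRing.Zmodule.on cohomology.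

Definition cohomology_class (f : cocycle) : cohomology := (\pi_cohomology f)%qT.

End Cohomology.

Section CohomologyMap.
Variables (C D : chain_complex) (f : chain_map C D) (G : zmodType) (k : nat).

Lemma cocycle_map_subproof (u : cocycle D G k) :
  hom_comp (val u) (cm f k) \in @is_cocycle C G k.
Proof.
case: u => u /= /is_cocycleP u0; apply/is_cocycleP => x.
by rewrite /= (cm_bd f (k := k.+1)) u0.
Qed.

Definition cocycle_map (u : cocycle D G k) : cocycle C G k :=
  Cocycle (cocycle_map_subproof u).

Definition cohomology_map (u : cohomology D G k) : cohomology C G k :=
  cohomology_class (cocycle_map (repr u)).
End CohomologyMap.

Section MappingCone.
Variables (C D : chain_complex) (f : chain_map C D).

(* C_(k-1), with C_(-1) = 0. *)
Definition shift_ch k : zmodType := if k is k'.+1 then C k' else 'rV[int]_0.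

Definition shift_bd k : {additive shift_ch k -> shift_ch k.-1} :=
  match k with
  | 0%N => \0
  | k'.+1 => match k' return {additive C k' -> shift_ch k'} with
             | 0%N => \0
             | k''.+1 => @bd C k''.+1
             end
  end.

Definition shift_cm k : {additive shift_ch k -> D k.-1} :=
  match k with
  | 0%N => \0
  | k'.+1 => cm f k'
  end.

(* D_k x C_(k-1); for f_* : C(A) -> C(X) this is C_k(X) x C_(k-1)(A). *)
Definition cone_ch k : zmodType := (D k * shift_ch k)%type.

Definition cone_bd_fun k (x : cone_ch k) : cone_ch k.-1 :=
  (bd k x.1 + shift_cm k x.2, - shift_bd k x.2).

Let pair_ext (U V : Type) (x y : U * V) : x.1 = y.1 -> x.2 = y.2 -> x = y.
Proof. by case: x y => ? ? [? ?] /= -> ->. Qed.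

Lemma cone_bd_zmod_morphism k : zmod_morphism (@cone_bd_fun k).
Proof.
move=> x y; apply: pair_ext.
  change (bd k (x.1 - y.1) + shift_cm k (x.2 - y.2) =
    bd k x.1 + shift_cm k x.2 - (bd k y.1 + shift_cm k y.2)).
  by rewrite !raddfB addrACA opprD.
change (- shift_bd k (x.2 - y.2) = - shift_bd k x.2 - - shift_bd k y.2).
by rewrite raddfB opprD.
Qed.
HB.instance Definition _ k :=
  GRing.isZmodMorphism.Build (cone_ch k) (cone_ch k.-1) (@cone_bd_fun k)
    (@cone_bd_zmod_morphism k).

Lemma cone_bd0 x : cone_bd_fun (k := 0) x = 0.
Proof.
apply: pair_ext; first by rewrite /= bd0 addr0.
by rewrite /= oppr0.
Qed.

Lemma shift_bdK k x : shift_bd k.-1 (shift_bd k x) = 0.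
Proof. by case: k x => [|[|[|k]]] x //=; exact: (@bdK C k.+2). Qed.

Lemma shift_cm_bd k x : shift_cm k.-1 (shift_bd k x) = bd k.-1 (shift_cm k x).
Proof.
case: k x => [|[|k]] x /=; rewrite ?raddf0 ?bd0 //.
exact: (cm_bd f (k := k.+1)).
Qed.

Lemma cone_bdK k x : cone_bd_fun (cone_bd_fun (k := k) x) = 0.
Proof.
apply: pair_ext.
  change (bd k.-1 (bd k x.1 + shift_cm k x.2) + shift_cm k.-1 (- shift_bd k x.2) = 0).
  by rewrite raddfD bdK add0r raddfN shift_cm_bd subrr.
change (- shift_bd k.-1 (- shift_bd k x.2) = 0).
by rewrite raddfN opprK shift_bdK.
Qed.

Definition cone : chain_complex := @ChainComplex cone_ch
  (fun k => @cone_bd_fun k : {additive _ -> _}) cone_bd0 cone_bdK.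
End MappingCone.

Section RelativeComplex.
Variables (C D : chain_complex) (f : chain_map C D).

Definition in_image k : {pred D k} := [pred x | `[< exists y : C k, x = cm f k y >] ].
Lemma in_imageP k (x : D k) :
  reflect (exists y : C k, x = cm f k y) (x \in @in_image k).
Proof. exact: asboolP. Qed.
Lemma in_image_closed k : zmod_closed (@in_image k).
Proof.
split=> [|x y]; first by apply/in_imageP; exists 0; rewrite raddf0.
move=> /in_imageP[x' ->] /in_imageP[y' ->]; apply/in_imageP.
by exists (x' - y'); rewrite raddfB.
Qed.
HB.instance Definition _ k :=
  GRing.isZmodClosed.Build (D k) (@in_image k) (@in_image_closed k).

Definition rel_ch k : zmodType := Quotient.quot (@in_image k).

Definition rel_class k : {additive D k -> rel_ch k} := (\pi_(rel_ch k))%qT.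

Definition rel_bd_fun k (x : rel_ch k) : rel_ch k.-1 := rel_class k.-1 (bd k (repr x)).

Lemma rel_class_eq0 k (x : D k) : rel_class k x = 0 <-> exists y : C k, x = cm f k y.
Proof.
have E : (x \in @in_image k) = (rel_class k x == 0).
  by rewrite -(raddf0 (rel_class k)) -Quotient.idealrBE subr0.
by split=> [/eqP|/in_imageP]; [rewrite -E => /in_imageP|rewrite E => /eqP].
Qed.

Lemma rel_class_repr k (x : rel_ch k) : rel_class k (repr x) = x.
Proof. exact: reprK. Qed.

Lemma rel_bd_class k (x : D k) : rel_bd_fun (rel_class k x) = rel_class k.-1 (bd k x).
Proof.
apply/subr0_eq; rewrite -[LHS]raddfB -raddfB; apply/rel_class_eq0.
have /rel_class_eq0[y ->] : rel_class k (repr (rel_class k x) - x) = 0.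
  by rewrite raddfB rel_class_repr subrr.
by exists (bd k y); rewrite cm_bd.
Qed.

Lemma rel_bd_zmod_morphism k : zmod_morphism (@rel_bd_fun k).
Proof.
move=> x y; rewrite -(rel_class_repr x) -(rel_class_repr y) -raddfB.
by rewrite !rel_bd_class -[RHS]raddfB -raddfB.
Qed.
HB.instance Definition _ k :=
  GRing.isZmodMorphism.Build (rel_ch k) (rel_ch k.-1) (@rel_bd_fun k)
    (@rel_bd_zmod_morphism k).

Lemma rel_bd0 x : rel_bd_fun (k := 0) x = 0.
Proof. by rewrite /rel_bd_fun bd0 raddf0. Qed.

Lemma rel_bdK k x : rel_bd_fun (rel_bd_fun (k := k) x) = 0.
Proof. by rewrite {2}/rel_bd_fun rel_bd_class bdK raddf0. Qed.

Definition relative : chain_complex := @ChainComplex rel_ch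
  (fun k => @rel_bd_fun k : {additive _ -> _}) rel_bd0 rel_bdK.

Definition cone_to_rel_fun k (x : cone f k) : relative k := rel_class k x.1.
Lemma cone_to_rel_zmod_morphism k : zmod_morphism (@cone_to_rel_fun k).
Proof. by move=> x y; rewrite /cone_to_rel_fun /= raddfB. Qed.
HB.instance Definition _ k :=
  GRing.isZmodMorphism.Build (cone f k) (relative k) (@cone_to_rel_fun k)
    (@cone_to_rel_zmod_morphism k).

Lemma cone_to_rel_bd k x :
  cone_to_rel_fun (bd k x) = bd k (cone_to_rel_fun x).
Proof.
rewrite [RHS]rel_bd_class /cone_to_rel_fun; apply/subr0_eq; rewrite -raddfB.
apply/rel_class_eq0; case: k x => [|k] x; last first.
  by exists x.2; rewrite [X in X - _]addrC addrK.
by exists 0; rewrite raddf0 [X in X - _]addrC addrK.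
Qed.

Definition cone_to_rel : chain_map (cone f) relative := @ChainMap _ _
  (fun k => @cone_to_rel_fun k : {additive _ -> _}) cone_to_rel_bd.
End RelativeComplex.

Section Characters.
Context {R : realType}.

Definition singular (M : manifold R) : chain_complex :=
  @ChainComplex (chains M) (sing_bd M) (fun=> erefl) (@sing_bdK R M).

Definition push (M N : manifold R) (f : smap M N) :
    chain_map (singular M) (singular N) :=
  @ChainMap (singular M) (singular N) (push_chain f) (@push_chain_bd R M N f).

Section CharactersOfComplex.
Variables (C : chain_complex) (k : nat).

Definition char_hom := hom (cycle C k.-1) (U1 R).
HB.instance Definition _ := GRing.Zmodule.on char_hom.

(* [w] is the real cochain given by integration of curvature (and covariant
   derivative), [ht] a real lift of [h], and [mu] the integral cocycle
   [w] - delta [ht]. *)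
Definition char_cocycle (h : char_hom) (w : C k -> R) (mu : cocycle C int k) : Prop :=
  exists ht : hom (C k.-1) R,
    (forall z : cycle C k.-1, h z = exp2pii (ht (val z))) /\
    (forall x, (val mu x)%:~R = w x - ht (bd k x)).

(* The default value 0 is never taken on differential characters: the class exists
   and does not depend on the lift. *)
Definition char_class (h : char_hom) (w : C k -> R) : cohomology C int k :=
  xget 0 [set cohomology_class mu | mu in char_cocycle h w].

(* j(u)(z) = <u, [z]> for u in H^(k-1)(C; U(1)). *)
Definition coh_incl (u : cohomology C (U1 R) k.-1) : char_hom :=
  hom_comp (val (repr u)) (val : {additive cycle C k.-1 -> C k.-1}).

End CharactersOfComplex.

Section MappingConeCharacters.
Variables (A X : manifold R) (f : smap A X) (k : nat).

(* Characters of degree k >= 1: homomorphisms on (k-1)-cycles. *)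
Definition shift_integral : form A k.-1 -> shift_ch (singular A) k -> R :=
  match k return form A k.-1 -> shift_ch (singular A) k -> R with
  | 0%N => fun _ _ => 0
  | k'.+1 => fun th b => integral th b
  end.

Definition cone_integral (w : form X k * form A k.-1) (x : cone (push f) k) : R :=
  integral w.1 x.1 + shift_integral w.2 x.2.

Definition is_curv_cov (h : char_hom (cone (push f)) k) (w : form X k * form A k.-1) :=
  forall x : cone (push f) k, h (bd_cycle x) = exp2pii (cone_integral w x).

Definition cone_char : set (char_hom (cone (push f)) k) :=
  [set h | exists w, is_curv_cov h w].

(* For k >= 2 the pair is unique when it exists. *)
Definition curv_cov (h : char_hom (cone (push f)) k) : form X k * form A k.-1 :=
  xget (form0 X k, form0 A k.-1) [set w | is_curv_cov h w].

Definition cone_curv h : form X k := (curv_cov h).1.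
Definition cone_cov h : form A k.-1 := (curv_cov h).2.

Definition cone_char_class h : cohomology (cone (push f)) int k :=
  char_class h (cone_integral (curv_cov h)).

Definition parallel_char : set (char_hom (cone (push f)) k) :=
  [set h | cone_char h /\ cone_cov h = form0 A k.-1].

Local Notation rel := (relative (push f)).

(* The first clause says that the integral of [w] over relative chains is well
   defined. *)
Definition is_rel_curv (h : char_hom rel k) (w : form X k) :=
  (forall c c' : chains X k, rel_class (push f) k c = rel_class (push f) k c' ->
     integral w c = integral w c') /\
  (forall c : chains X k,
     h (@bd_cycle rel k (rel_class (push f) k c)) = exp2pii (integral w c)).

Definition rel_char : set (char_hom rel k) := [set h | exists w, is_rel_curv h w].

Definition rel_curv (h : char_hom rel k) : form X k :=
  xget (form0 X k) [set w | is_rel_curv h w].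

Definition rel_integral (w : form X k) (x : rel k) : R :=
  integral w (repr (x : rel_ch (push f) k)).

Definition rel_char_class (h : char_hom rel k) : cohomology rel int k :=
  char_class h (rel_integral (rel_curv h)).

Definition char_pullback (h : char_hom rel k) : char_hom (cone (push f)) k :=
  hom_comp h (@cycle_map _ _ (cone_to_rel (push f)) k.-1).

Definition class_pullback (G : zmodType) (l : nat) :
    cohomology rel G l -> cohomology (cone (push f)) G l :=
  cohomology_map (cone_to_rel (push f)) (G := G) (k := l).

End MappingConeCharacters.
End Characters.

Arguments rel_char {R A X} f k.
Arguments cone_char {R A X} f k.
Arguments parallel_char {R A X} f k.
Arguments char_pullback {R A X f k} h.

Definition is_subgroup (V : zmodType) (S : set V) :=
  S 0 /\ forall x y, S x -> S y -> S (x - y).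

(* Main.v *)
(** The projection [q : (s, t) |-> [s]] on (k-1)-cycles is onto because the push-forward
    of chains along an injective map is injective, and a cycle in its kernel is the
    boundary of some [(0, b)], on which a character takes the value
    [exp (2 pi i \int_b cov)]. Hence [h |-> h \o q] is injective, and its image consists
    of the characters that vanish on these boundaries, the parallel ones; for such a
    character the integral of the curvature over every chain of [A] is an integer.

    That a form of positive degree with integral periods on all simplices vanishes
    (and hence that curvature and covariant derivative are unique) is seen on small affine
    simplices in a chart: the integral over a simplex of size [e] is of order [e ^+ k],
    so it cannot be a nonzero integer when [e] is small.

    For the characteristic classes, a character lifts to a real cochain because U(1)
    is divisible and chain groups are free; the same argument one degree lower shows that
    two lifts differ by an integral cochain up to a coboundary. Stokes' formula is not
    needed: if integration of the curvature is not a cocycle, no integral cocycle exists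
    on either side and both classes have the default value 0. *)

Require Import Defs.
From HB Require Import structures.
From mathcomp Require Import freeg.
From mathcomp Require Import all_boot all_order all_algebra ring_quotient complex.
From mathcomp Require Import zify ring lra.
From mathcomp Require Import all_classical all_reals all_analysis.
From mathcomp Require Import measurable_realfun.

Set Implicit Arguments.
Unset Strict Implicit.
Unset Printing Implicit Defensive.

Import Order.TTheory GRing.Theory Num.Theory.
Import numFieldNormedType.Exports.
Local Open Scope classical_set_scope.
Local Open Scope ring_scope.

(** * The circle group as a divisible group *)

Section CircleGroup.
Context {R : realType}.

Lemma exp2piiD (x y : R) : exp2pii (x + y) = exp2pii x + exp2pii y.
Proof.
apply: val_inj => /=; rewrite mulrDr cosD sinD /GRing.mul /=.
by congr (_ +i* _)%C; rewrite addrC.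
Qed.

Lemma exp2pii0 : exp2pii (0 : R) = 0.
Proof. by apply: (addIr (exp2pii 0)); rewrite -exp2piiD !add0r. Qed.

Lemma exp2piiB (x y : R) : exp2pii (x - y) = exp2pii x - exp2pii y.
Proof. by apply: (addIr (exp2pii y)); rewrite -exp2piiD !subrK. Qed.

Lemma exp2pii_int (m : int) : exp2pii (m%:~R : R) = 0.
Proof.
have n0 n : exp2pii (n%:R : R) = 0.
  elim: n => [|n IH]; first exact: exp2pii0.
  rewrite -natr1 exp2piiD IH add0r; apply: val_inj => /=.
  by rewrite mulr1 mulr_natl cos2pi sin2pi.
case: (intP m) => [|n|n]; rewrite ?exp2pii0 // ?n0 //.
by rewrite mulrNz -[X in X = _]addr0 -(n0 n.+1) -exp2piiD addNr exp2pii0.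
Qed.

(** Once the integer part is removed, a remainder [0 < r < 1] would give [sin (pi * r) > 0], hence
    [cos (2 * pi * r) < 1] by the double angle formula. *)
Lemma exp2pii_eq0 (x : R) : exp2pii x = 0 -> exists m : int, x = m%:~R.
Proof.
move=> ex0; exists (Num.floor x).
have : exp2pii (x - (Num.floor x)%:~R) = 0 by rewrite exp2piiB exp2pii_int ex0 subrr.
have /andP[fx xf] := floor_itv x.
set r := x - _ => er0; suff : r = 0 by move/subr0_eq.
have [r0 r1] : 0 <= r /\ r < 1.
  by rewrite /r subr_ge0 fx ltrBlDr (lt_le_trans xf) // intrD addrC.
apply/eqP; rewrite eq_le r0 andbT leNgt; apply/negP => rgt0.
have : cos (2 * pi * r) = 1 by have /(congr1 val) [] := er0.
have -> : 2 * pi * r = (pi * r) *+ 2 by rewrite -mulrA mulr_natl.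
rewrite cos_mulr2n => c1.
have s0 : 0 < sin (pi * r).
  by rewrite sin_gt0_pi // mulr_gt0 ?pi_gt0 //= gtr_pMr ?pi_gt0.
have := cos2Dsin2 (pi * r); have := exprn_gt0 2 s0; lra.
Qed.

Lemma exp2pii_eq (x y : R) : exp2pii x = exp2pii y -> exists m : int, x - y = m%:~R.
Proof. by move=> xy; apply: exp2pii_eq0; rewrite exp2piiB xy subrr. Qed.

Lemma exp2pii_surj (u : U1 R) : exists x : R, exp2pii x = u.
Proof.
case: u => [[a b] uP]; have ab : a ^+ 2 + b ^+ 2 = 1.
  have := uP; rewrite normc_def /= => /eqP[] /(congr1 (fun t => t ^+ 2)).
  by rewrite sqr_sqrtr ?expr1n // addr_ge0 ?sqr_ge0.
have b0 := sqr_ge0 b; have a1 : -1 <= a <= 1 by apply/andP; split; nra.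
(* [acos] only reaches the upper half circle; the sign of [b] selects the angle. *)
pose t := if 0 <= b then acos a else - acos a.
have ca : cos (acos a) = a by rewrite acosK // in_itv.
have sa : sin (acos a) = `|b|.
  by rewrite sin_acos // -sqrtr_sqr; congr Num.sqrt; rewrite -ab addrC addKr.
have [ct st] : cos t = a /\ sin t = b.
  rewrite /t; case: ifPn => b0'; first by rewrite ca sa ger0_norm.
  by rewrite cosN sinN ca sa ltr0_norm ?opprK // ltNge.
exists (t / (2 * pi)); apply: val_inj => /=; rewrite mulrC divfK ?ct ?st //.
by rewrite mulf_neq0 // gt_eqF ?pi_gt0.
Qed.

Definition divisible (U : zmodType) :=
  forall (u : U) (n : nat), (0 < n)%N -> exists v : U, v *+ n = u.

Lemma U1_divisible : divisible (U1 R).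
Proof.
move=> u n n0; have [x <-] := exp2pii_surj u; exists (exp2pii (x / n%:R)).
have E m : exp2pii (x / n%:R) *+ m = exp2pii (x / n%:R * m%:R).
  elim: m => [|m IH]; first by rewrite mulr0n mulr0 exp2pii0.
  by rewrite mulrSr IH -exp2piiD -natr1 mulrDr mulr1.
by rewrite E divfK // pnatr_eq0 -lt0n.
Qed.
End CircleGroup.

Definition hom_of (U V : zmodType) (f : U -> V) (fB : zmod_morphism f) : Defs.hom U V :=
  HB.pack_for {additive U -> V} f (GRing.isZmodMorphism.Build U V f fB).

(** * Extension of homomorphisms into divisible groups *)

Section DivisibleExtension.
Context {C U : zmodType}.

(* The graph of a homomorphism from a subgroup of [C] to [U]. *)
Definition partial_hom (S : set (C * U)) :=
  [/\ S (0, 0), forall x y u v, S (x, u) -> S (y, v) -> S (x - y, u - v) &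
      forall u, S (0, u) -> u = 0].

Lemma partial_homD S x y u v : partial_hom S ->
  S (x, u) -> S (y, v) -> S (x + y, u + v).
Proof.
case=> S0 SB _ Sp Sq; rewrite -[y]opprK -[v]opprK; apply: (SB) => //.
by rewrite -[- y]sub0r -[- v]sub0r; exact: SB.
Qed.

Lemma partial_homMz S x u n : partial_hom S -> S (x, u) -> S (x *~ n, u *~ n).
Proof.
move=> hS Sx; have [S0 SB _] := hS.
have Sn m : S (x *+ m, u *+ m).
  by elim: m => [|m IH]; rewrite ?mulr0n // !mulrSr; exact: partial_homD.
case: n => n; first exact: Sn.
rewrite NegzE !mulrNz -[X in (X, _)]sub0r -[X in (_, X)]sub0r.
by apply: SB => //; exact: Sn.
Qed.

Lemma partial_hom_fun S x u v : partial_hom S -> S (x, u) -> S (x, v) -> u = v.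
Proof.
by move=> [_ SB Sf] Su Sv; apply/subr0_eq/Sf; rewrite -(subrr x); exact: SB.
Qed.

(** The integers [n] with [x *~ n] in the domain of [S] are the multiples of one [d]. For [d > 0]
    the value at [x] has to be a [d]-th part of the value at [x *+ d], which divisibility provides;
    for [d = 0] any value is consistent and 0 is taken. *)
Lemma partial_hom_step S x : divisible U -> partial_hom S ->
  exists2 S', partial_hom S' & S `<=` S' /\ exists u, S' (x, u).
Proof.
move=> dU hS; have [S0 SB Sf] := hS.
have [a aP] : exists a, forall (n : int) u, S (x *~ n, u) -> u = a *~ n.
  have [D0|D0] := pselect (exists n, (0 < n)%N /\ exists b, S (x *+ n, b)); last first.
    exists 0 => n u Su; have n0 : n = 0.
      apply/eqP/negP => n0; apply: D0; exists `|n|%N; split; first by rewrite absz_gt0; apply/negP.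
      case: n {n0} Su => n Su; first by exists u.
      exists (- u); rewrite NegzE mulrNz in Su.
      by have := SB _ _ _ _ S0 Su; rewrite !sub0r opprK.
    by rewrite n0 mulr0z in Su *; exact: Sf.
  have D0' : exists n, (0 < n)%N && `[< exists b, S (x *+ n, b) >].
    by case: D0 => n [n0 Dn]; exists n; rewrite n0; exact/asboolP.
  case: (ex_minnP D0') => d /andP[d0 /asboolP[b Sb]] dmin.
  have [a ab] := dU b d d0; exists a => n u Su.
  (* The remainder of [n] modulo [d] again gives a multiple of [x] in the domain, so minimality of
     [d] forces it to be 0. *)
  have Sr : S (x *~ (n %% d)%Z, u - b *~ (n %/ d)%Z).
    have := SB _ _ _ _ Su (partial_homMz (n %/ d)%Z hS Sb).
    rewrite -[x *+ d]/(x *~ d) -mulrzA -mulrzBr {1}(divz_eq n d).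
    by rewrite [d%:Z * _]mulrC [X in x *~ X]addrC addKr.
  have r0 : (n %% d)%Z = 0.
    have rd : (n %% d)%Z < d by rewrite ltz_pmod.
    have : 0 <= (n %% d)%Z by rewrite modz_ge0 // gt_eqF.
    case: (n %% d)%Z rd Sr => // [[//|r]] rd Sr _.
    suff : (d <= r.+1)%N by move: rd; rewrite ltz_nat ltnNge => /negPf ->.
    by apply: dmin => /=; apply/asboolP; eexists; exact: Sr.
  rewrite r0 mulr0z in Sr; rewrite (subr0_eq (Sf _ Sr)) -ab.
  by rewrite -[a *+ d]/(a *~ d) -mulrzA [in RHS](divz_eq n d) r0 addr0 mulrC.
pose S' := [set p : C * U | exists (n : int) y v, S (y, v) /\ p = (y + x *~ n, v + a *~ n)].
exists S'; last first.
  split=> [[y v] Sq|]; first by exists 0, y, v; rewrite !mulr0z !addr0.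
  by exists a, 1, 0, 0; rewrite !mulr1z !add0r.
split.
- by exists 0, 0, 0; rewrite !mulr0z !addr0.
- move=> _ _ _ _ [n [y [v [Sq [-> ->]]]]] [n' [y' [v' [Sq' [-> ->]]]]].
  exists (n - n'), (y - y'), (v - v').
  split; first exact: SB.
  by congr (_, _); rewrite mulrzBr opprD addrACA.
move=> _ [n [y [v [Sq [/esym y0 ->]]]]].
have : S (x *~ - n, v) by rewrite mulrNz -(addr0_eq y0) opprK.
by move/aP ->; rewrite mulrNz addNr.
Qed.

Lemma divisible_extension (S : set (C * U)) : divisible U -> partial_hom S ->
  exists H : Defs.hom C U, forall x u, S (x, u) -> H x = u.
Proof.
move=> dU hS; have [S0 SB _] := hS.
(* Zorn's lemma is applied to the sets [T] whose union with [S] is a graph, so that the empty chain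
   is no exception: there the union is [S] itself. *)
have chain F : F `<=` [set T | partial_hom (S `|` T)] -> total_on F subset ->
    partial_hom (S `|` \bigcup_(X in F) X).
  move=> FP Ftot; split; first by left.
  - have FB X x y u v : F X -> (S `|` X) (x, u) -> (S `|` X) (y, v) ->
        (S `|` \bigcup_(X in F) X) (x - y, u - v).
      by move=> FX Xx Xy; have [_ /(_ _ _ _ _ Xx Xy)[]] := FP X FX; [left|right; exists X].
    move=> x y u v [Sx|[X FX Xx]] [Sy|[Y FY Yy]].
    + by left; exact: SB.
    + by apply: (FB Y) => //; [left|right].
    + by apply: (FB X) => //; [right|left].
    + by have [XY|YX] := Ftot _ _ FX FY; [apply: (FB Y)|apply: (FB X)] => //; right; auto.
  - move=> u [|[X FX Xu]]; first by case: hS => _ _; apply.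
    by have [_ _] := FP X FX; apply; right.
have [T [hT Tmax]] := Zorn_bigcup chain.
have dom x : exists u, (S `|` T) (x, u).
  have [S' hS' [TS' [u Su]]] := partial_hom_step x dU hT.
  have SS' : S `|` S' = S' by apply/setUidPr => y Sy; apply: TS'; left.
  exists u; have [//|nTu] := pselect ((S `|` T) (x, u)).
  case: (Tmax S'); last by rewrite /= SS'.
  split=> [y Ty|/(_ _ Su) Tu]; first by apply: TS'; right.
  by apply: nTu; right.
pose H x := projT1 (cid (dom x)); have HP x : (S `|` T) (x, H x) by rewrite /H; case: cid.
have HB : zmod_morphism H.
  move=> x y; apply: (partial_hom_fun hT (HP _)); case: (hT) => _ TB _.
  exact: TB.
exists (hom_of HB) => x u Sx.
by apply: (partial_hom_fun hT (HP x)); left.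
Qed.
End DivisibleExtension.

(** * Lifting characters to real cochains *)

Section RealLifts.
Context {R : realType}.

HB.instance Definition _ :=
  GRing.isZmodMorphism.Build R (U1 R) (@exp2pii R) (@exp2piiB R).

(** Singular chain groups have this property because they are free. Relative chain groups appear as
    quotients without a given basis, so the lifting property itself is carried along in place of
    freeness. *)
Definition liftable (V : zmodType) :=
  forall H : Defs.hom V (U1 R), exists g : Defs.hom V R, forall x, H x = exp2pii (g x).

Lemma freeg_liftable (K : choiceType) : liftable {freeg K / int}.
Proof.
move=> H; pose g s := projT1 (cid (exp2pii_surj (H << s >>))).
exists (zlift g) => D.
apply: (@freeg_additive_ext _ _ H (@exp2pii R \o zlift g)) => s /=.
by rewrite zliftU /g; case: cid.
Qed.

Lemma prod_liftable (V W : zmodType) : liftable V -> liftable W -> liftable (V * W)%type.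
Proof.
move=> lV lW H.
have Bl : zmod_morphism (fun x : V => H (x, 0)).
  by move=> x y; rewrite -raddfB; congr (H (_, _)); rewrite subr0.
have Br : zmod_morphism (fun y : W => H (0, y)).
  by move=> x y; rewrite -raddfB; congr (H (_, _)); rewrite subr0.
have [gl glE] := lV (hom_of Bl).
have [gr grE] := lW (hom_of Br).
have gB : zmod_morphism (fun p : V * W => gl p.1 + gr p.2).
  by move=> p q /=; rewrite !raddfB addrACA opprD.
exists (hom_of gB).
move=> [x y] /=; rewrite exp2piiD -glE -grE /= -raddfD.
by congr (H (_, _)); rewrite ?addr0 ?add0r.
Qed.

(** The lift is chosen on simplices, with value 0 on those that factor through [f]. Its linear
    extension then vanishes on pushed-forward chains and descends to the quotient. *)
Lemma rel_class_liftable (A X : manifold R) (f : smap A X) k :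
  liftable (rel_ch (push f) k).
Proof.
move=> H; pose P (s : ssimplex X k) := `[< exists s', s = push_simplex f s' >].
pose g (s : ssimplex X k) : R := if P s then 0 else
  projT1 (cid (exp2pii_surj (H (rel_class (push f) k << s >>)))).
have g0 y : zlift g (push_chain f k y) = 0.
  apply: (@freeg_additive_ext _ _ (zlift g \o push_chain f k) \0) => s /=.
  rewrite zliftU zliftU /g; suff -> : P (push_simplex f s) by [].
  by apply/asboolP; exists s.
have gE x y : rel_class (push f) k x = rel_class (push f) k y -> zlift g x = zlift g y.
  move=> xy; have /rel_class_eq0[z zE] : rel_class (push f) k (x - y) = 0.
    by rewrite raddfB xy subrr.
  by apply/subr0_eq; rewrite -raddfB zE; exact: g0.
have gB : zmod_morphism (fun x : rel_ch (push f) k => zlift g (repr x)).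
  by move=> x y; rewrite -raddfB; apply: gE; rewrite raddfB !rel_class_repr.
exists (hom_of gB) => x /=.
rewrite -{1}(rel_class_repr x).
apply: (@freeg_additive_ext _ _ (H \o rel_class (push f) k) (@exp2pii R \o zlift g)) => s /=.
rewrite zliftU /g; case: ifPn => [/asboolP[s' ->]|_]; last by case: cid.
rewrite exp2pii0 -(raddf0 H); congr (H _); apply/rel_class_eq0.
by exists << s' >>; rewrite /= zliftU.
Qed.

Lemma cone_liftable (A X : manifold R) (f : smap A X) k : liftable (cone (push f) k).
Proof.
apply: prod_liftable; first exact: freeg_liftable.
case: k => [|k]; last exact: freeg_liftable.
move=> H; exists 0 => x; have -> : x = 0 by apply/matrixP => ? [].
by rewrite raddf0 /= exp2pii0.
Qed.

Lemma cohomology_classP (C : chain_complex) (G : zmodType) k (mu nu : cocycle C G k) :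
  (exists g : Defs.hom (C k.-1) G, forall x, val mu x - val nu x = g (bd k x)) <->
  cohomology_class mu = cohomology_class nu.
Proof.
have E : (mu - nu \in @is_coboundary C G k) = (cohomology_class mu == cohomology_class nu).
  by rewrite Quotient.idealrBE.
split=> [[g gE]|/eqP]; first by apply/eqP; rewrite -E; apply/is_coboundaryP; exists g.
by rewrite -E => /is_coboundaryP[g gE]; exists g.
Qed.

(** Liftability concerns homomorphisms on all chains, while a character lives on cycles only;
    divisibility of U(1) bridges the gap. *)
Lemma char_lift (C : chain_complex) k (h : @char_hom R C k) : liftable (C k.-1) ->
  exists ht : Defs.hom (C k.-1) R, forall z : Defs.cycle C k.-1, h z = exp2pii (ht (val z)).
Proof.
move=> lC.
have [|H HE] := @divisible_extension (C k.-1) (U1 R)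
    [set p | exists z : Defs.cycle C k.-1, p = (val z, h z)] U1_divisible.
  split=> [|_ _ _ _ [z [-> ->]] [z' [-> ->]]|u [z [/esym z0 ->]]].
  - by exists (0 : Defs.cycle C k.-1); rewrite (raddf0 h).
  - by exists (z - z'); rewrite (raddfB h).
  - by rewrite -(raddf0 h); congr (h _); exact: val_inj.
have [ht htE] := lC H; exists ht => z; rewrite -htE; symmetry.
by apply: HE; exists z.
Qed.

(** Both [w x] and [ht (bd k x)] exponentiate to the value of [h] on the boundary of [x], so they
    differ by an integer. This integral cochain is a cocycle because [w] vanishes on boundaries. *)
Lemma char_cocycle_exists (C : chain_complex) k (h : @char_hom R C k)
    (w : Defs.hom (C k) R) : liftable (C k.-1) ->
  (forall x, h (bd_cycle x) = exp2pii (w x)) -> (forall y : C k.+1, w (bd k.+1 y) = 0) ->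
  exists mu, char_cocycle h w mu.
Proof.
move=> lC hw w0; have [ht htE] := char_lift h lC.
have wZ x : exists m : int, w x - ht (bd k x) = m%:~R.
  by apply: exp2pii_eq; rewrite -hw htE.
pose m x := projT1 (cid (wZ x)).
have mE x : (m x)%:~R = w x - ht (bd k x) by rewrite /m; case: cid.
have mB : zmod_morphism m.
  move=> x y; apply: (@intr_inj R).
  by rewrite intrB !mE (raddfB w) (raddfB (bd k)) (raddfB ht); lra.
pose ma := hom_of mB.
have mc : ma \in @is_cocycle C int k.
  by apply/is_cocycleP => y; apply: (@intr_inj R); rewrite /= mE w0 (bdK (k := k.+1)) raddf0 subrr.
by exists (Cocycle mc), ht.
Qed.

(** The difference [d] of two lifts is integral on cycles, so its exponential factors through the
    boundary map and extends to a homomorphism on chains one degree lower, with real lift [g]. Then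
    [d] minus the coboundary of [g] is integral, and its coboundary is [mu - nu]. *)
Lemma char_cocycle_unique (C : chain_complex) k (h : @char_hom R C k) w mu nu :
  liftable (C k.-1.-1) -> char_cocycle h w mu -> char_cocycle h w nu ->
  cohomology_class mu = cohomology_class nu.
Proof.
move=> lC [ht [htE muE]] [hs [hsE nuE]].
pose d : Defs.hom (C k.-1) R := hs - ht.
have dE x : d x = hs x - ht x by [].
have [|H HE] := @divisible_extension (C k.-1.-1) (U1 R)
    [set p | exists x : C k.-1, p = (bd k.-1 x, exp2pii (d x))] U1_divisible.
  split=> [|_ _ _ _ [z [-> ->]] [z' [-> ->]]|u [z [/esym z0 ->]]].
  - by exists 0; rewrite (raddf0 (bd k.-1)) (raddf0 d) exp2pii0.
  - by exists (z - z'); rewrite (raddfB (bd k.-1)) (raddfB d) -exp2piiB.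
  - have zc : z \in is_cycle (k := k.-1) by rewrite inE z0.
    have := htE (Cycle zc); rewrite hsE /= => e.
    by rewrite exp2piiB e subrr.
have [g gE] := lC H.
have nZ x : exists m : int, d x - g (bd k.-1 x) = m%:~R.
  by apply: exp2pii_eq; rewrite -gE; symmetry; apply: HE; exists x.
pose n x := projT1 (cid (nZ x)).
have nE x : (n x)%:~R = d x - g (bd k.-1 x) by rewrite /n; case: cid.
have nB : zmod_morphism n.
  move=> x y; apply: (@intr_inj R).
  by rewrite intrB !nE (raddfB d) (raddfB (bd k.-1)) (raddfB g); lra.
apply/cohomology_classP.
exists (hom_of nB) => x /=.
apply: (@intr_inj R); rewrite intrB muE nuE nE bdK raddf0 subr0 dE; lra.
Qed.

Lemma char_classE (C : chain_complex) k (h : @char_hom R C k) w mu :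
  liftable (C k.-1.-1) -> char_cocycle h w mu -> char_class h w = cohomology_class mu.
Proof.
move=> lC hmu; rewrite /char_class; case: xgetP => [_ -> [nu hnu <-]|].
  exact: char_cocycle_unique hnu hmu.
by move=> /(_ (cohomology_class mu)) []; exists mu.
Qed.

(** [cohomology_map] works on a chosen representative; another one differs by a coboundary, which a
    chain map pulls back to a coboundary. *)
Lemma cohomology_map_class (C D : chain_complex) (f : chain_map C D) (G : zmodType) k
    (mu : cocycle D G k) :
  cohomology_map f (cohomology_class mu) = cohomology_class (cocycle_map f mu).
Proof.
have /cohomology_classP[g gE] : cohomology_class (repr (cohomology_class mu)) =
    cohomology_class mu by exact: reprK.
apply/cohomology_classP; exists (hom_comp g (cm f k.-1)) => x /=.
by rewrite gE cm_bd.
Qed.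

Lemma coh_incl_class (C : chain_complex) k (mu : cocycle C (U1 R) k.-1) (z : Defs.cycle C k.-1) :
  @coh_incl R C k (cohomology_class mu) z = val mu (val z).
Proof.
have /cohomology_classP[g gE] : cohomology_class (repr (cohomology_class mu)) =
    cohomology_class mu by exact: reprK.
apply/subr0_eq; rewrite /= gE; case: z => z /= /eqP z0.
by rewrite z0 raddf0.
Qed.

End RealLifts.

(** * Iterated integrals over the unit cube *)

Section IteratedIntegral.
Context {R : realType}.
Implicit Types (F G : R -> R) (M : R).

Local Notation lambda := (@lebesgue_measure R).

Definition unit_bounded M F := (forall x, `|F x| <= M) /\
  (forall x, ~~ (0 <= x <= 1) -> F x = 0).

Lemma lebesgue_unit : lambda `[0, 1]%classic = 1%E.
Proof. by rewrite lebesgue_measure_itv /= lte_fin ltr01 sube0. Qed.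

Lemma unit_cst_integrable M : lambda.-integrable setT (EFin \o (cst M \_ `[0, 1])).
Proof.
rewrite -restrict_EFin; apply: (integrable_mkcond _ _).1 => //.
apply: measurable_bounded_integrable => //.
  by have := lebesgue_unit => /= ->; rewrite ltry.
by exists `|M|; split; [exact: num_real|move=> y /ltW yM x _ /=].
Qed.

Lemma unit_bounded_integrable M F : measurable_fun setT F -> unit_bounded M F ->
  lambda.-integrable setT (EFin \o F).
Proof.
move=> mF bF; apply: le_integrable (unit_cst_integrable M) => //.
  by apply/measurable_EFinP.
move=> x _; rewrite /= lee_fin; case: (bF) => FM F0.
rewrite patchE mem_setE in_itv /=; case: ifPn => [_|/F0 ->]; last by rewrite normr0.
exact: le_trans (FM x) (ler_norm _).
Qed.

Lemma unit_Rintegral_cst M : \int[lambda]_x (cst M \_ `[0, 1]) x = M.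
Proof.
rewrite -Rintegral_mkcond Rintegral_cst //.
by have := lebesgue_unit => /= ->; rewrite mulr1.
Qed.

Lemma unit_Rintegral_bound M F : measurable_fun setT F -> unit_bounded M F ->
  `|\int[lambda]_x F x| <= M.
Proof.
move=> mF bF; have iF := unit_bounded_integrable mF bF.
apply: le_trans (le_normr_Rintegral _ iF) _ => //.
rewrite -[leRHS](unit_Rintegral_cst M); apply: le_Rintegral => //.
- by have := integrable_norm iF.
- exact: unit_cst_integrable.
move=> x _; case: (bF) => FM F0.
by rewrite patchE mem_setE in_itv /=; case: ifPn => [_|/F0 ->] //; rewrite normr0.
Qed.

Lemma unit_dominated_cvg M (Fn : nat -> R -> R) F :
  (forall n, measurable_fun setT (Fn n)) -> (forall n, unit_bounded M (Fn n)) ->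
  (forall x, Fn n x @[n --> \oo] --> F x) ->
  \int[lambda]_x Fn n x @[n --> \oo] --> \int[lambda]_x F x.
Proof.
move=> mFn bFn FnF.
have mF : measurable_fun setT F by apply: measurable_fun_cvg mFn _ => x _; exact: FnF.
have [|||||iF _ ] := @dominated_convergence _ _ _ lambda setT measurableT
  (fun n => EFin \o Fn n) (EFin \o F) (EFin \o (cst M \_ `[0, 1])).
- by move=> n; apply/measurable_EFinP; exact: mFn.
- by apply/(measurable_EFinP setT F).
- by apply: aeW => x _; apply/fine_cvgP; split; [exact: nearW|exact: FnF].
- exact: unit_cst_integrable.
- apply: aeW => x n _; rewrite /= lee_fin; have [FM F0] := bFn n.
  by rewrite patchE mem_setE in_itv /=; case: ifPn => [_|/F0 ->] //; rewrite normr0.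
by move=> cF; apply: fine_cvg; rewrite fineK //; exact: integrable_fin_num iF.
Qed.

Definition cube k (x : 'rV[R]_k) := forall i, 0 <= x 0 i <= 1.

Definition cube_bounded k M (f : 'rV[R]_k -> R) :=
  (forall x, `|f x| <= M) /\ (forall x, ~ cube x -> f x = 0).

Lemma cvg_rV (T : Type) (F : set_system T) {FF : Filter F} k (f : T -> 'rV[R]_k)
    (l : 'rV[R]_k) :
  (forall i, f t 0 i @[t --> F] --> l 0 i) -> f @ F --> l.
Proof.
move=> fl A [P lP PA].
have : \forall t \near F, forall i, P 0 i (f t 0 i).
  by apply: filter_forall => i; exact: fl (lP 0 i).
by apply: filterS => t Pt; apply: PA => i j; rewrite ord1; exact: Pt.
Qed.

Lemma continuous_at_fst (T U V : topologicalType) (h : T * U -> V) t u :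
  {for (t, u), continuous h} -> {for t, continuous (fun t => h (t, u))}.
Proof.
move=> ch; apply: (cvg_comp (fun t => (t, u)) h _ ch).
exact: cvg_pair cvg_id (cvg_cst _).
Qed.

Lemma continuous_at_snd (T U V : topologicalType) (h : T * U -> V) t u :
  {for (t, u), continuous h} -> {for u, continuous (fun u => h (t, u))}.
Proof.
move=> ch; apply: (cvg_comp (fun u => (t, u)) h _ ch).
exact: cvg_pair (cvg_cst _) cvg_id.
Qed.

Definition slice k (f : 'rV[R]_k.+1 -> R) (x : R) : 'rV[R]_k -> R :=
  fun y => f (row_mx x%:M y).

Lemma iterated_integralS k (f : 'rV[R]_k.+1 -> R) :
  iterated_integral f = \int[lambda]_x iterated_integral (slice f x).
Proof. by []. Qed.

Lemma iterated_integral0 k : iterated_integral (fun _ : 'rV[R]_k => 0) = 0.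
Proof.
elim: k => [//|k IH]; rewrite iterated_integralS.
under eq_Rintegral do rewrite IH.
by rewrite Rintegral_cst // mul0r.
Qed.

Lemma row_mx_scalar0 k (x : R) (y : 'rV[R]_k) :
  (row_mx x%:M y : 'rV[R]_k.+1) 0 ord0 = x.
Proof.
have -> : ord0 = lshift k ord0 :> 'I_(1 + k) by exact: val_inj.
by rewrite (row_mxEl x%:M y) mxE.
Qed.

Lemma row_mx_scalarS k (x : R) (y : 'rV[R]_k) j :
  (row_mx x%:M y : 'rV[R]_k.+1) 0 (lift ord0 j) = y 0 j.
Proof.
have -> : lift ord0 j = rshift 1 j :> 'I_(1 + k) by exact: val_inj.
by rewrite (row_mxEr x%:M y).
Qed.

Lemma cube_row_mx k (x : R) (y : 'rV[R]_k) :
  cube (row_mx x%:M y : 'rV_k.+1) <-> 0 <= x <= 1 /\ cube y.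
Proof.
split=> [c|[x01 cy] i].
  split=> [|i]; first by have := c ord0; rewrite row_mx_scalar0.
  by have := c (lift ord0 i); rewrite row_mx_scalarS.
by case: (unliftP ord0 i) => [j|] ->; rewrite ?row_mx_scalarS ?row_mx_scalar0.
Qed.

Lemma cube_bounded_slice k M (f : 'rV[R]_k.+1 -> R) x :
  cube_bounded M f -> cube_bounded M (slice f x).
Proof.
by move=> [fM f0]; split=> [y|y cy]; [exact: fM|apply: f0 => /cube_row_mx[]].
Qed.

Lemma slice_out k M (f : 'rV[R]_k.+1 -> R) x :
  cube_bounded M f -> ~~ (0 <= x <= 1) -> iterated_integral (slice f x) = 0.
Proof.
move=> [_ f0] x01; rewrite -(iterated_integral0 k); congr iterated_integral.
by apply/funext => y; apply: f0 => /cube_row_mx[x01' _]; rewrite x01' in x01.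
Qed.

(** By compactness of the unit interval, [g t x] is close to [g t0 x] uniformly in [x] once [t] is
    near [t0]; outside the interval both vanish. *)
Lemma unit_continuous_param (T : topologicalType) M (g : T -> R -> R) :
  continuous (fun z : T * R => g z.1 z.2) -> (forall t, unit_bounded M (g t)) ->
  continuous (fun t => \int[lambda]_x g t x).
Proof.
move=> cg bg t0; have mg t : measurable_fun setT (g t).
  apply: continuous_measurable_fun => x.
  exact: (continuous_at_snd (cg (t, x))).
apply/cvgrPdist_le => e e0.
have /compact_near_coveringP cov : compact (`[0, 1]%classic : set R) by exact: segment_compact.
have near0 : \forall t \near t0, `[0, 1] `<=` (fun x => `|g t0 x - g t x| <= e).
  apply: cov => x _.
  have e2 : 0 < e / 2 by rewrite divr_gt0.
  have /cvgrPdist_lt/(_ (e / 2) e2) := cg (t0, x).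
  move=> [[U V] /= [Ut Vx] UV]; exists (V, U) => //= -[x' t] /= [Vx' Ut'].
  have := UV (t, x') (conj Ut' Vx'); have := UV (t0, x') (conj (nbhs_singleton Ut) Vx').
  move=> /= /ltW h1 /ltW h2; rewrite [e]splitr.
  rewrite -(subrKA (g t0 x)); apply: le_trans (ler_normD _ _) (lerD _ h2).
  by rewrite distrC.
apply: filterS near0 => t tE.
rewrite -RintegralB //; try exact: (unit_bounded_integrable (mg _) (bg _)).
apply: unit_Rintegral_bound; first exact: measurable_funB.
split=> [x|x x01].
  have [x01|x01] := boolP (0 <= x <= 1).
    by apply: tE; rewrite /= in_itv.
  by rewrite (bg t0).2 // (bg t).2 // subrr normr0 ltW.
by rewrite (bg t0).2 // (bg t).2 // subrr.
Qed.

(** The parameter space is arbitrary so that the induction can absorb the first coordinate into it,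
    passing from [T] to [T * R]. *)
Lemma iterated_integral_continuous_param k (T : topologicalType) M (f : T -> 'rV[R]_k -> R) :
  continuous (fun z : T * 'rV[R]_k => f z.1 z.2) -> (forall t, cube_bounded M (f t)) ->
  continuous (fun t => iterated_integral (f t)) /\
  forall t, `|iterated_integral (f t)| <= M.
Proof.
elim: k T f => [|k IH] T f cf bf.
  split=> [t|t]; last exact: (bf t).1.
  exact: (continuous_at_fst (cf (t, 0))).
have [|t|cg bg] := IH (T * R)%type (fun p => slice (f p.1) p.2).
- move=> z.
  have c1 : z'.1.1 @[z' --> z] --> z.1.1 by exact: (cvg_comp fst fst cvg_fst cvg_fst).
  have c2 : (row_mx z'.1.2%:M z'.2 : 'rV[R]_k.+1) @[z' --> z] -->
      (row_mx z.1.2%:M z.2 : 'rV[R]_k.+1).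
    apply: cvg_rV => i; case: (unliftP ord0 i) => [j|] ->.
      under eq_fun do rewrite row_mx_scalarS.
      rewrite row_mx_scalarS.
      exact: (cvg_comp snd (fun y : 'rV[R]_k => y 0 j) cvg_snd (@coord_continuous _ _ _ 0 j _)).
    under eq_fun do rewrite row_mx_scalar0.
    rewrite row_mx_scalar0.
    exact: (cvg_comp fst snd cvg_fst cvg_snd).
  exact: (cvg_comp _ (fun z => f z.1 z.2) (cvg_pair c1 c2) (cf (_, _))).
- exact: cube_bounded_slice.
have bg' t : unit_bounded M (fun x => iterated_integral (slice (f t) x)).
  split=> [x|x x01]; first exact: (bg (t, x)).
  exact: slice_out (bf t) x01.
split; first exact: (unit_continuous_param cg bg').
move=> t; apply: unit_Rintegral_bound (bg' t).
apply: continuous_measurable_fun => x.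
exact: (continuous_at_snd (cg (t, x))).
Qed.

(* Iterated integrals of these functions are limits of integrals of continuous
   functions, so no measurability on ['rV_k] is needed. *)
Definition bounded_limit k M (f : 'rV[R]_k -> R) := exists fn : nat -> 'rV[R]_k -> R,
  [/\ forall n, continuous (fn n), forall n, cube_bounded M (fn n) &
      forall x, fn n x @[n --> \oo] --> f x].

Lemma slice_continuous k (f : 'rV[R]_k.+1 -> R) : continuous f ->
  continuous (fun z : R * 'rV[R]_k => slice f z.1 z.2).
Proof.
move=> cf z.
have c2 : (row_mx z'.1%:M z'.2 : 'rV[R]_k.+1) @[z' --> z] -->
    (row_mx z.1%:M z.2 : 'rV[R]_k.+1).
  apply: cvg_rV => i; case: (unliftP ord0 i) => [j|] ->.
    under eq_fun do rewrite row_mx_scalarS.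
    rewrite row_mx_scalarS.
    exact: (cvg_comp snd (fun y : 'rV[R]_k => y 0 j) cvg_snd (@coord_continuous _ _ _ 0 j _)).
  under eq_fun do rewrite row_mx_scalar0.
  rewrite row_mx_scalar0.
  exact: cvg_fst.
exact: (cvg_comp _ f c2 (cf _)).
Qed.

Lemma continuous_slice k (f : 'rV[R]_k.+1 -> R) x : continuous f -> continuous (slice f x).
Proof.
move=> cf y.
apply: (@continuous_at_snd _ _ _ (fun z : R * 'rV[R]_k => slice f z.1 z.2) x y).
exact: slice_continuous.
Qed.

Lemma bounded_limit_slice k M (f : 'rV[R]_k.+1 -> R) x :
  bounded_limit M f -> bounded_limit M (slice f x).
Proof.
move=> [fn [cfn bfn fnf]]; exists (fun n => slice (fn n) x); split.
- by move=> n; exact: continuous_slice.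
- by move=> n; exact: cube_bounded_slice.
- by move=> y; exact: fnf.
Qed.

Lemma cube_bounded_lim k M (fn : nat -> 'rV[R]_k -> R) f :
  (forall n, cube_bounded M (fn n)) -> (forall x, fn n x @[n --> \oo] --> f x) ->
  cube_bounded M f.
Proof.
move=> bfn fnf; split=> [x|x cx].
  apply: (cvgr_to_le (cvg_norm (fnf x))); apply: nearW => n; exact: (bfn n).1.
apply: (cvg_unique _ (fnf x)) => //.
have -> : (fun n => fn n x) = cst 0 by apply/funext => n; exact: (bfn n).2.
exact: cvg_cst.
Qed.

Lemma iterated_integral_slice_continuous k M (f : 'rV[R]_k.+1 -> R) :
  continuous f -> cube_bounded M f ->
  continuous (fun x => iterated_integral (slice f x)) /\
  unit_bounded M (fun x => iterated_integral (slice f x)).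
Proof.
move=> cf bf; have bs x := cube_bounded_slice x bf.
have [cI bI] := iterated_integral_continuous_param (slice_continuous cf) bs.
by split=> //; split=> // x x01; exact: slice_out bf x01.
Qed.

(** Dominated convergence is used one variable at a time; the inner integrals of the continuous
    [fn n] are continuous, hence measurable. *)
Lemma iterated_integral_cvg k M (fn : nat -> 'rV[R]_k -> R) f :
  (forall n, continuous (fn n)) -> (forall n, cube_bounded M (fn n)) ->
  (forall x, fn n x @[n --> \oo] --> f x) ->
  iterated_integral (fn n) @[n --> \oo] --> iterated_integral f.
Proof.
elim: k fn f => [|k IH] fn f cfn bfn fnf; first exact: fnf.
have H n := iterated_integral_slice_continuous (cfn n) (bfn n).
apply: (unit_dominated_cvg (M := M)).
- by move=> n; apply: continuous_measurable_fun; case: (H n).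
- by move=> n; case: (H n).
move=> x; apply: IH.
- by move=> n; exact: continuous_slice.
- by move=> n; exact: cube_bounded_slice.
- by move=> y; exact: fnf.
Qed.

(** The inner integrals of the approximants are continuous in [x] and converge pointwise, so the
    limit is measurable with the same bound. *)
Lemma iterated_integral_slice k M (f : 'rV[R]_k.+1 -> R) : bounded_limit M f ->
  measurable_fun setT (fun x => iterated_integral (slice f x)) /\
  unit_bounded M (fun x => iterated_integral (slice f x)).
Proof.
move=> [fn [cfn bfn fnf]].
have H n := iterated_integral_slice_continuous (cfn n) (bfn n).
have cI x : iterated_integral (slice (fn n) x) @[n --> \oo] --> iterated_integral (slice f x).
  apply: (iterated_integral_cvg (M := M)).
  - by move=> n; exact: continuous_slice.
  - by move=> n; exact: cube_bounded_slice.
  - by move=> y; exact: fnf.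
split.
  apply: (measurable_fun_cvg _ (fun x _ => cI x)) => n.
  by apply: continuous_measurable_fun; case: (H n).
split=> [x|x x01]; last exact: slice_out (cube_bounded_lim bfn fnf) x01.
by apply: (cvgr_to_le (cvg_norm (cI x))); apply: nearW => n; exact: (H n).2.1.
Qed.

Lemma iterated_integral_slice_integrable k M (f : 'rV[R]_k.+1 -> R) : bounded_limit M f ->
  lambda.-integrable setT (EFin \o (fun x => iterated_integral (slice f x))).
Proof. by move=> /iterated_integral_slice[mF bF]; exact: unit_bounded_integrable bF. Qed.

Lemma iterated_integralB k M M' (f g : 'rV[R]_k -> R) :
  bounded_limit M f -> bounded_limit M' g ->
  iterated_integral (fun x => f x - g x) = iterated_integral f - iterated_integral g.
Proof.
elim: k f g => [//|k IH] f g bf bg; rewrite !iterated_integralS.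
rewrite -RintegralB //; try by [exact: iterated_integral_slice_integrable bf
  |exact: iterated_integral_slice_integrable bg].
apply: eq_Rintegral => x _; rewrite -IH //; exact: bounded_limit_slice.
Qed.

Lemma iterated_integral_ge0 k (f : 'rV[R]_k -> R) :
  (forall x, 0 <= f x) -> 0 <= iterated_integral f.
Proof.
elim: k f => [|k IH] f f0; first exact: f0.
by rewrite iterated_integralS; apply: Rintegral_ge0 => x _; apply: IH => y; exact: f0.
Qed.

Lemma iterated_integral_le k M B (f : 'rV[R]_k -> R) : bounded_limit M f ->
  (forall x, f x <= B) -> iterated_integral f <= B.
Proof.
elim: k f => [|k IH] f bf fB; first exact: fB.
rewrite iterated_integralS -[leRHS]unit_Rintegral_cst; apply: le_Rintegral => //.
- exact: iterated_integral_slice_integrable bf.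
- exact: unit_cst_integrable.
move=> x _; rewrite patchE mem_setE in_itv /=; case: ifPn => [_|x01].
  by apply: IH => [|y]; [exact: bounded_limit_slice|exact: fB].
by case: (iterated_integral_slice bf) => _ [_ ->].
Qed.

Lemma iterated_integral_ge k M m a (f : 'rV[R]_k -> R) : bounded_limit M f ->
  0 <= m -> 0 < a -> (forall x, 0 <= f x) ->
  (forall x : 'rV[R]_k, (forall i, 0 < x 0 i < a) -> m <= f x) ->
  m * a ^+ k <= iterated_integral f.
Proof.
move=> + m0 a0; elim: k f => [|k IH] f bf f0 fm.
  by rewrite expr0 mulr1; apply: fm => -[].
rewrite iterated_integralS.
have mE : m * a ^+ k.+1 = \int[lambda]_x (cst (m * a ^+ k) \_ `]0, a[) x.
  rewrite -Rintegral_mkcond Rintegral_cst //=.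
  by rewrite lebesgue_measure_itv /= lte_fin a0 /= subr0 exprSr mulrA.
rewrite mE; apply: le_Rintegral => //.
- rewrite -restrict_EFin; apply: (integrable_mkcond _ _).1 => //.
  apply: measurable_bounded_integrable => //.
    by rewrite /= lebesgue_measure_itv /= lte_fin a0 /= ltry.
  by exists `|m * a ^+ k|; split; [exact: num_real|move=> y /ltW yM x _ /=].
- exact: iterated_integral_slice_integrable bf.
move=> x _; rewrite patchE mem_setE in_itv /=; case: ifPn => [x01|_].
  apply: IH => [|y|y y01]; [exact: bounded_limit_slice|exact: f0|].
  apply: fm => i; case: (unliftP ord0 i) => [j|] ->; first by rewrite row_mx_scalarS.
  by rewrite row_mx_scalar0.
by apply: iterated_integral_ge0 => y; exact: f0.
Qed.

End IteratedIntegral.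

(** * Functions supported on the open simplex *)

Section OpenSimplex.
Context {R : realType}.

Definition open_simplex k (x : 'rV[R]_k) := [forall i, 0 < x 0 i] && (\sum_i x 0 i < 1).

(** Each factor [t + |t|] is twice the positive part of a barycentric coordinate, so the product is
    continuous and positive exactly inside the simplex. *)
Definition simplex_bump k (x : 'rV[R]_k) : R :=
  (\prod_i (x 0 i + `|x 0 i|)) * ((1 - \sum_i x 0 i) + `|1 - \sum_i x 0 i|).

Lemma addr_norm_gt0 (a : R) : (0 < a + `|a|) = (0 < a).
Proof.
have [a0|a0] := leP a 0; first by rewrite ler0_norm // subrr ltxx.
by rewrite gtr0_norm // addr_gt0.
Qed.

Lemma addr_norm_ge0 (a : R) : 0 <= a + `|a|.
Proof. by rewrite -lerBlDl sub0r -normrN ler_norm. Qed.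

Lemma simplex_bump_ge0 k (x : 'rV[R]_k) : 0 <= simplex_bump x.
Proof. by rewrite mulr_ge0 ?prodr_ge0 // => *; exact: addr_norm_ge0. Qed.

Lemma simplex_bump_gt0 k (x : 'rV[R]_k) : (0 < simplex_bump x) = open_simplex x.
Proof.
apply/idP/idP => [b0|/andP[/forallP x0 x1]]; last first.
  by rewrite mulr_gt0 ?prodr_gt0 ?addr_norm_gt0 ?subr_gt0 // => i _; rewrite addr_norm_gt0.
have : simplex_bump x != 0 by rewrite gt_eqF.
rewrite mulf_eq0 negb_or => /andP[/prodf_neq0 x0 x1]; apply/andP; split; last first.
  by rewrite -subr_gt0 -addr_norm_gt0 lt0r x1 addr_norm_ge0.
by apply/forallP => i; rewrite -addr_norm_gt0 lt0r (x0 i isT) addr_norm_ge0.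
Qed.

Lemma coord_sum_continuous k : continuous (fun x : 'rV[R]_k => \sum_i x 0 i).
Proof.
move=> x; exact: (Cn_sum openT (fun i => @smooth_on_coord R k i 0%N) x I).
Qed.

Lemma simplex_bump_continuous k : continuous (@simplex_bump k).
Proof.
have cN (T : topologicalType) (f : T -> R) a : {for a, continuous f} ->
    {for a, continuous (fun x => f x + `|f x|)}.
  by move=> fa; exact: cvgD fa (cvg_norm fa).
have cS (T : topologicalType) (f : T -> R) a : {for a, continuous f} ->
    {for a, continuous (fun x => 1 - f x)}.
  by move=> fa; apply: cvgB fa; exact: cvg_cst.
have c1 : continuous (fun x : 'rV[R]_k => 1 - \sum_i x 0 i).
  by move=> x; exact: cS (@coord_sum_continuous k x).
have c2 : continuous (fun x : 'rV[R]_k => \prod_i (x 0 i + `|x 0 i|)).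
  apply: (@continuous_big R _ *%R 1 xpredT (@mul_continuous R)) => i _ x.
  exact: cN (@coord_continuous _ _ _ 0 i x).
by move=> x; exact: cvgM (c2 x) (cN _ _ _ (c1 x)).
Qed.

Lemma open_simplex_near k (x : 'rV[R]_k) : open_simplex x ->
  \forall x' \near x, open_simplex x'.
Proof.
rewrite -simplex_bump_gt0 => x0.
by apply: filterS (cvgr_gt _ (@simplex_bump_continuous k x) _ x0) => y; rewrite simplex_bump_gt0.
Qed.

Lemma open_simplex_cube k (x : 'rV[R]_k) : open_simplex x -> cube x.
Proof.
move=> /andP[/forallP x0 x1] i; rewrite ltW //= (le_trans _ (ltW x1)) //.
by rewrite (bigD1 i) //= lerDl sumr_ge0 // => j _; exact: ltW.
Qed.

Lemma continuous_atM (T : topologicalType) (f g : T -> R) a :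
  {for a, continuous f} -> {for a, continuous g} -> {for a, continuous (fun x => f x * g x)}.
Proof. by move=> cf cg; exact: cvgM cf cg. Qed.

Lemma continuous_at_squeeze0 (T : topologicalType) (f g : T -> R) a :
  {for a, continuous g} -> g a = 0 -> (forall y, `|f y| <= g y) -> {for a, continuous f}.
Proof.
move=> cg ga fg; apply/cvgrPdist_le => e e0.
have fa : f a = 0 by apply/eqP; rewrite -normr_le0 -ga.
move/cvgrPdist_le/(_ e e0): cg; apply: filterS => y.
rewrite ga fa !sub0r !normrN; apply: le_trans.
exact: le_trans (fg y) (ler_norm _).
Qed.

(** The approximants are [f] times the cutoffs [min (1, n * simplex_bump)], which kill a possible
    jump of [f] at the boundary and are eventually 1 at each interior point. *)
Lemma open_simplex_bounded_limit k M (f : 'rV[R]_k -> R) :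
  (forall x, `|f x| <= M) -> (forall x, ~~ open_simplex x -> f x = 0) ->
  (forall x, open_simplex x -> {for x, continuous f}) -> bounded_limit M f.
Proof.
move=> fM f0 cf; pose b (n : nat) (x : 'rV[R]_k) : R := Num.min 1 (n%:R * simplex_bump x).
have b_ge0 n x : 0 <= b n x by rewrite le_min ler01 mulr_ge0 // simplex_bump_ge0.
have cM (T : topologicalType) (g : T -> R) a c : {for a, continuous g} ->
    {for a, continuous (fun x => Num.min 1 (c * g x))}.
  move=> ga; apply: (@continuous_min R T (cst 1) (fun x => c * g x)).
    exact: cvg_cst.
  exact: cvgMl_tmp.
have cM' (T : topologicalType) (g : T -> R) a c d : {for a, continuous g} ->
    {for a, continuous (fun x => c * g x * d)}.
  by move=> ga; apply: cvgMr_tmp; exact: cvgMl_tmp.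
have cb n : continuous (b n) by move=> x; apply: cM; exact: simplex_bump_continuous.
have bf n x : `|b n x * f x| <= M.
  rewrite normrM ger0_norm // -[leRHS]mul1r ler_pM //.
  by rewrite ge_min lexx.
exists (fun n x => b n x * f x); split=> [n x|n|x].
- have [sx|nsx] := boolP (open_simplex x); first exact: continuous_atM (cb n x) (cf x sx).
  have bx0 : simplex_bump x = 0.
    by apply/eqP; rewrite eq_le simplex_bump_ge0 andbT leNgt simplex_bump_gt0.
  (* At a point outside, where [f] may be discontinuous, the product is squeezed by a continuous
     function that vanishes there. *)
  apply: (@continuous_at_squeeze0 _ _ (fun y => n%:R * simplex_bump y * M)).
  - by apply: cM'; exact: simplex_bump_continuous.
  - by rewrite bx0 mulr0 mul0r.
  move=> y; rewrite normrM (ger0_norm (b_ge0 n y)) ler_pM //.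
  by rewrite ge_min lexx orbT.
- split=> // x cx; rewrite f0 ?mulr0 //.
  by apply/negP => /open_simplex_cube.
have [sx|nsx] := boolP (open_simplex x); last first.
  have -> : (fun n => b n x * f x) = cst (f x).
    by apply/funext => n; rewrite /= f0 // mulr0.
  exact: cvg_cst.
have bx : 0 < simplex_bump x by rewrite simplex_bump_gt0.
apply: (@cvg_trans _ (cst (f x) @ \oo)); last exact: cvg_cst.
apply: near_eq_cvg.
(* Beyond the inverse of [simplex_bump x] the cutoff at [x] equals 1. *)
exists (Num.bound (simplex_bump x)^-1) => // n /= Nn; rewrite /b min_l ?mul1r //.
rewrite -ler_pdivrMr // div1r.
apply: (le_trans (ltW (archi_boundP _))); first by rewrite invr_ge0 ltW.
by rewrite ler_nat.
Qed.

End OpenSimplex.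

(** * Forms in charts *)

Section Multilinear.
Context {R : realType} {V : lmodType R} {k : nat}.

Definition multilinear (L : ('I_k -> V) -> R) := forall v i a u z,
  L (dfwith v i (a *: u + z)) = a * L (dfwith v i u) + L (dfwith v i z).

Context {L : ('I_k -> V) -> R} (mL : multilinear L).

Lemma multilinear0 v i : L (dfwith v i 0) = 0.
Proof.
have := mL v i 1 0 0; rewrite scaler0 addr0 mul1r => /eqP.
by rewrite -subr_eq0 opprD addNKr oppr_eq0 => /eqP.
Qed.

Lemma multilinearZ v i a u : L (dfwith v i (a *: u)) = a * L (dfwith v i u).
Proof. by have := mL v i a u 0; rewrite addr0 multilinear0 addr0. Qed.

Lemma multilinear_sum v i m (x : 'I_m -> R) (e : 'I_m -> V) :
  L (dfwith v i (\sum_l x l *: e l)) = \sum_l x l * L (dfwith v i (e l)).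
Proof.
elim: m x e => [|m IH] x e; first by rewrite !big_ord0 multilinear0.
by rewrite !big_ord_recl mL IH.
Qed.

Lemma multilinear_scale v a : L (fun i => a *: v i) = a ^+ k * L v.
Proof.
have H n : (n <= k)%N -> L (fun i => if (i < n)%N then a *: v i else v i) = a ^+ n * L v.
  elim: n => [|n IH] nk; first by rewrite mul1r.
  pose f (i : 'I_k) := if (i < n)%N then a *: v i else v i.
  have -> : (fun i : 'I_k => if (i < n.+1)%N then a *: v i else v i) =
      dfwith f (Ordinal nk) (a *: v (Ordinal nk)).
    apply/funext => i; case: dfwithP => [|j]; first by rewrite /= ltnS leqnn.
    by rewrite /f ltnS leq_eqVlt -val_eqE /= eq_sym => /negPf ->.
  rewrite (multilinearZ f) exprS -mulrA -(IH (ltnW nk)); congr (_ * L _).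
  apply/funext => i; case: dfwithP => [|j //].
  by rewrite /f /= ltnn.
rewrite -H //; congr L; apply/funext => i.
by rewrite ltn_ord.
Qed.

End Multilinear.

Lemma continuous_at_sum {R : realType} (T : topologicalType) m (F : 'I_m -> T -> R) a :
  (forall i, {for a, continuous (F i)}) -> {for a, continuous (fun x => \sum_i F i x)}.
Proof.
elim: m F => [|m IH] F cF.
  have -> : (fun x => \sum_i F i x) = cst 0 by apply/funext => x; rewrite big_ord0.
  exact: cvg_cst.
have -> : (fun x => \sum_i F i x) = (fun x => F ord0 x + \sum_i F (lift ord0 i) x).
  by apply/funext => x; rewrite big_ord_recl.
by apply: cvgD; [exact: cF|apply: IH => i; exact: cF].
Qed.

Section FormInChart.
Context {R : realType} {M : manifold R} {k : nat}.
Implicit Types (w : Defs.form M k) (c d : @chart R M (mdim M)).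

(** The expression of [w] in the chart [c], for which [form_smooth] gives smoothness in [y] with the
    vectors held fixed. *)
Definition form_chart w c (y : 'rV[R]_(mdim M)) (v : 'I_k -> 'rV[R]_(mdim M)) : R :=
  w (cinv c y) (fun i => 'd (chart_at (cinv c y) \o cinv c) y (v i)).

Lemma form_chart_multilinear w c y : multilinear (form_chart w c y).
Proof.
have E (f : 'rV[R]_(mdim M) -> 'rV[R]_(mdim M)) (v : 'I_k -> 'rV[R]_(mdim M)) i u :
    (fun j => f (dfwith v i u j)) = dfwith (f \o v) i (f u).
  by apply/funext => j; case: dfwithP => [|j' ij]; rewrite ?dfwithin ?dfwithout.
by move=> v i a u z; rewrite /form_chart !E linearP form_linear.
Qed.

Lemma form_chart_continuous w c (T : topologicalType) (a : T)
    (z : T -> 'rV[R]_(mdim M)) (u : 'I_k -> T -> 'rV[R]_(mdim M)) :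
  atlas c -> ccod c (z a) -> {for a, continuous z} ->
  (forall i, {for a, continuous (u i)}) ->
  {for a, continuous (fun y => form_chart w c (z y) (fun i => u i y))}.
Proof.
move=> ac cz zc uc.
(* Induction on the number of slots in which [u] varies. *)
suff H n : forall u : 'I_k -> T -> 'rV[R]_(mdim M), (forall i, {for a, continuous (u i)}) ->
    (forall (i : 'I_k) y, (n <= i)%N -> u i y = u i a) ->
    {for a, continuous (fun y => form_chart w c (z y) (fun i => u i y))}.
  by apply: (H k) => // i y; rewrite leqNgt ltn_ord.
elim: n => [|n IH] {}u {}uc un.
  have -> : (fun y => form_chart w c (z y) (fun i => u i y)) =
      (fun x => form_chart w c x (fun i => u i a)) \o z.
    by apply/funext => y /=; congr (form_chart _ _ _ _); apply/funext => i; rewrite un.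
  apply: continuous_comp => //.
  exact: (form_smooth w (fun i => u i a) ac 0%N _ cz).
have [nk|kn] := ltnP n k; last first.
  by apply: IH => // i y ni; apply: un; case: ltngtP ni (leq_trans (ltn_ord i) kn).
pose i0 := Ordinal nk.
(* The vector in slot [n] is expanded in the standard basis; its variation moves into scalar
   coefficients and the slot becomes constant. *)
have -> : (fun y => form_chart w c (z y) (fun i => u i y)) =
    (fun y => \sum_l u i0 y 0 l *
      form_chart w c (z y) (fun i => dfwith (fun i => u i y) i0 (delta_mx 0 l) i)).
  apply/funext => y; rewrite -(multilinear_sum (form_chart_multilinear w c (z y))).
  rewrite -row_sum_delta; congr (form_chart _ _ _ _); apply/funext => i.
  by case: dfwithP.
apply: continuous_at_sum => l; apply: continuous_atM.
  exact: (@continuous_comp _ _ _ (u i0) (fun t : 'rV[R]_(mdim M) => t 0 l) a (uc i0)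
    (@coord_continuous _ _ _ 0 l _)).
apply: (IH (fun i y => dfwith (fun i => u i y) i0 (delta_mx 0 l) i)) => [i|i y ni].
  have [<-|ii0] := eqVneq i0 i.
    rewrite (_ : (fun y => _) = cst (delta_mx 0 l)); first exact: cvg_cst.
    by apply/funext => y; rewrite dfwithin.
  rewrite (_ : (fun y => _) = u i); first exact: uc.
  by apply/funext => y; rewrite dfwithout.
have [<-|ii0] := eqVneq i0 i; first by rewrite !dfwithin.
rewrite !dfwithout //; apply: un; rewrite ltn_neqAle ni andbT.
by rewrite -(inj_eq val_inj) in ii0.
Qed.

Lemma transition_differentiable c d y : atlas c -> atlas d -> ccod c y ->
  cdom d (cinv c y) -> differentiable (d \o cinv c) y.
Proof. by move=> ac ad cy dy; have [+ _] := atlas_smooth ac ad 1; exact. Qed.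

End FormInChart.

(** * Continuity and boundedness of densities *)

Section Density.
Context {R : realType} {M : manifold R} {k : nat}.
Implicit Types (w : Defs.form M k) (c d : @chart R M (mdim M)) (s : ssimplex M k).

Lemma corner0 (x : 'rV[R]_k) : corner x 0 ord0 = 1 - \sum_i x 0 i.
Proof. exact: row_mx_scalar0. Qed.

Lemma cornerS (x : 'rV[R]_k) i : corner x 0 (lift ord0 i) = x 0 i.
Proof. exact: row_mx_scalarS. Qed.

Lemma corner_smooth : smooth_on setT (@corner R k).
Proof.
move=> n; apply: Cn_rV; first exact: openT.
move=> i; case: (unliftP ord0 i) => [j|] ->.
  apply: (Cn_near openT _ (smooth_on_coord j n)) => x _; first by rewrite cornerS.
have cS := Cn_sum openT (fun j => @smooth_on_coord R k j n).
have cN := CnM openT (Cn_cst n (-1 : R) openT) cS.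
apply: (Cn_near openT _ (CnD openT (Cn_cst n (1 : R) openT) cN)) => x _.
by rewrite corner0 mulN1r.
Qed.

Lemma corner_in_simplex (x : 'rV[R]_k) : (forall i, 0 <= x 0 i) -> \sum_i x 0 i <= 1 ->
  in_simplex (corner x).
Proof.
move=> x0 x1; apply/andP; split.
  apply/forallP => i; case: (unliftP ord0 i) => [j|] ->; first by rewrite cornerS.
  by rewrite corner0 subr_ge0.
rewrite big_ord_recl corner0 [X in _ + X](eq_bigr (fun i => x 0 i)) ?subrK // => i _.
exact: cornerS.
Qed.

Lemma open_simplex_corner (x : 'rV[R]_k) : open_simplex x -> in_simplex (corner x).
Proof.
by move=> /andP[/forallP x0 x1]; apply: corner_in_simplex => [i|]; exact: ltW.
Qed.

(* A smooth extension of [simplex_param s] near a point of the closed simplex, read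
   in a chart. *)
Lemma simplex_param_local s (x0 : 'rV[R]_k) : in_simplex (corner x0) ->
  exists U c (G : 'rV[R]_k -> 'rV[R]_(mdim M)),
    [/\ open U, U x0, atlas c, smooth_on U G &
      forall x, U x -> in_simplex (corner x) ->
        ccod c (G x) /\ simplex_param s x = cinv c (G x)].
Proof.
pose pt x (sx : in_simplex (corner x)) : stdsimplex R k := exist _ (corner x) sx.
move=> sx0; have [U [c [g [oU Ux0 ac sg gE]]]] := simplex_smooth s (pt _ sx0).
have oU' : open (setT `&` @corner R k @^-1` U).
  by apply: openIpre => //; [exact: openT|move=> x _; exact: (corner_smooth 0)].
exists (setT `&` @corner R k @^-1` U), c, (g \o @corner R k); split=> //.
  apply: (smooth_on_comp oU' oU _ _ sg); first by move=> x [].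
  exact: smooth_on_sub (@subsetT _ _) corner_smooth.
move=> x [_ Ux] sx; rewrite /simplex_param.
have -> : insubd (vertex0 k) (corner x) = pt _ sx by apply: val_inj; rewrite val_insubd sx.
have [ds cs] := gE (pt _ sx) Ux; rewrite -[(g \o _) x]cs cmapK //.
by split=> //; exact: cmap_cod.
Qed.

(** The density is defined with the chart [chart_at p], which jumps with the point [p]. By the chain
    rule it can be read in one fixed chart, where continuity is visible. *)
Lemma simplex_density_chart w s c (G : 'rV[R]_k -> 'rV[R]_(mdim M)) x :
  atlas c -> open_simplex x -> differentiable G x -> ccod c (G x) ->
  (\forall x' \near x, simplex_param s x' = cinv c (G x')) ->
  simplex_density w s x = form_chart w c (G x) (fun i => 'D_(delta_mx 0 i) G x).
Proof.
move=> ac sx dG cG sG; rewrite /simplex_density ifT // /form_chart.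
rewrite (nbhs_singleton sG); congr (w _ _); apply/funext => i.
set d := chart_at _.
have dd : differentiable (d \o cinv c) (G x).
  by apply: transition_differentiable => //; [exact: chart_at_atlas|exact: chart_at_dom].
rewrite (near_eq_derive (g := (d \o cinv c) \o G)); last first.
  by apply: filterS sG => x' /= ->.
rewrite deriveE; last exact: differentiable_comp.
by rewrite diff_comp //= deriveE.
Qed.

Lemma simplex_density_out w s x : ~~ open_simplex x -> simplex_density w s x = 0.
Proof. by move=> /negPf nx; rewrite /simplex_density -/(open_simplex x) nx. Qed.

(** [T] is built from a smooth extension of the simplex, so it is continuous also at boundary
    points. This keeps the density bounded up to the boundary. *)
Lemma simplex_density_local w s (x0 : 'rV[R]_k) : in_simplex (corner x0) ->
  exists T : 'rV[R]_k -> R, {for x0, continuous T} /\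
    \forall x \near x0, open_simplex x -> simplex_density w s x = T x.
Proof.
move=> sx0; have [U [c [G [oU Ux0 ac sG GE]]]] := simplex_param_local s sx0.
exists (fun x => form_chart w c (G x) (fun i => 'D_(delta_mx 0 i) G x)); split.
  apply: (@form_chart_continuous _ _ _ w c _ x0 G (fun i x => 'D_(delta_mx 0 i) G x)) => //.
  - by case: (GE x0 Ux0 sx0).
  - exact: (sG 0).
  - by move=> i; have [_ /(_ (delta_mx 0 i))] := sG 1; apply.
have nU : \forall x \near x0, U x by exact: open_nbhs_nbhs.
apply: filterS nU => x Ux ox.
have [dG _] := sG 1; have [cG _] := GE x Ux (open_simplex_corner ox).
apply: simplex_density_chart => //; first exact: dG.
have nUx : \forall x' \near x, U x' by exact: open_nbhs_nbhs.
apply: filterS2 (open_simplex_near ox) nUx => x' ox' Ux'.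
by have [] := GE x' Ux' (open_simplex_corner ox').
Qed.

Lemma simplex_density_continuous w s x : open_simplex x ->
  {for x, continuous (simplex_density w s)}.
Proof.
move=> ox; have [T [cT TE]] := simplex_density_local w s (open_simplex_corner ox).
have nE : \forall x' \near x, T x' = simplex_density w s x'.
  by apply: filterS2 (open_simplex_near ox) TE => x' ox' /(_ ox') ->.
rewrite /prop_for /continuous_at -(nbhs_singleton nE).
exact: cvg_trans (near_eq_cvg nE) cT.
Qed.

Lemma not_open_simplex_near (x : 'rV[R]_k) : 1 < \sum_i x 0 i ->
  \forall x' \near x, ~~ open_simplex x'.
Proof.
move=> x1; apply: filterS (cvgr_gt _ (@coord_sum_continuous R k x) _ x1) => y y1.
by rewrite negb_and -leNgt (ltW y1) orbT.
Qed.

Lemma simplex_density_bounded w s : exists B, forall x, `|simplex_density w s x| <= B.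
Proof.
have cc : compact [set x : 'rV[R]_k | forall i, x ord0 i \in `[0, 1]].
  by apply: (@rV_compact _ _ (fun=> `[(0 : R), 1]%classic)) => i; exact: segment_compact.
move/compact_near_coveringP : cc.
(* Compactness of the cube turns local bounds, valid for all large [B], into a global one. Points
   with coordinate sum above 1 have a neighbourhood where the density is 0. *)
case/(_ R +oo (fun B x => `|simplex_density w s x| <= B)).
  move=> x0 cx0; have [sx0|sx0] := leP (\sum_i x0 0 i) 1; last first.
    have nx : \forall x \near x0, ~~ open_simplex x.
      exact: not_open_simplex_near.
    exists ([set x | ~~ open_simplex x], [set B | 0 <= B]) => /=.
      by split=> //; exact: nbhs_pinfty_ge.
    by move=> [x B] /= [nox B0]; rewrite simplex_density_out // normr0.
  have sx0' : in_simplex (corner x0).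
    by apply: corner_in_simplex => // i; have := cx0 i; rewrite /= in_itv /= => /andP[].
  have [T [cT TE]] := simplex_density_local w s sx0'.
  have Tb : \forall x \near x0, `|T x| < `|T x0| + 1.
    by apply: (cvgr_norm_lt _ cT); rewrite ltrDl.
  exists ([set x | (open_simplex x -> simplex_density w s x = T x) /\ `|T x| < `|T x0| + 1],
          [set B | `|T x0| + 1 <= B]) => /=.
    by split; [exact: filterI|exact: nbhs_pinfty_ge].
  move=> [x B] /= [[xT xb] xB].
  have [ox|nox] := boolP (open_simplex x); last first.
    by rewrite simplex_density_out // normr0 (le_trans _ xB) // addr_ge0.
  by rewrite xT // (le_trans _ xB) // ltW.
move=> B [_ BP]; exists `|B + 1| => x.
have [ox|nox] := boolP (open_simplex x); last by rewrite simplex_density_out // normr0.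
apply: le_trans (ler_norm _); apply: BP; first by rewrite ltrDl.
by move=> i /=; rewrite in_itv /=; exact: (open_simplex_cube ox).
Qed.

Lemma simplex_density_bounded_limit w s : exists B, bounded_limit B (simplex_density w s).
Proof.
have [B wB] := simplex_density_bounded w s; exists B.
apply: open_simplex_bounded_limit => //; first exact: simplex_density_out.
exact: simplex_density_continuous.
Qed.

Lemma integralU w s : Defs.integral w << s >> = iterated_integral (simplex_density w s).
Proof. exact: zliftU. Qed.

End Density.

(** * Differences of forms and vanishing of integrals *)

Section Forms.
Context {R : realType} {M : manifold R} {k : nat}.
Implicit Types w : Defs.form M k.

Lemma form_ext w1 w2 : (forall p v, w1 p v = w2 p v) -> w1 = w2.
Proof.
case: w1 => f1 l1 a1 s1; case: w2 => f2 l2 a2 s2 /= f12.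
have {}f12 : f1 = f2 by apply/funext => p; apply/funext => v; exact: f12.
case: _ / f12 in l2 a2 s2 *.
by rewrite (Prop_irrelevance l1 l2) (Prop_irrelevance a1 a2) (Prop_irrelevance s1 s2).
Qed.

Definition form_sub w1 w2 : Defs.form M k.
Proof.
refine (@Form R M k (fun p v => w1 p v - w2 p v) _ _ _).
- by move=> p v i a u z; rewrite !form_linear; ring.
- by move=> p v i j ij vij; rewrite !(form_alternating _ _ ij vij) subrr.
move=> c v ac n; have oc := @ccod_open _ _ _ c.
have cN := CnM oc (Cn_cst n (-1 : R) oc) (form_smooth w2 v ac n).
apply: (Cn_near oc _ (CnD oc (form_smooth w1 v ac n) cN)) => x _.
by rewrite mulN1r.
Defined.

Lemma simplex_density_sub w1 w2 (s : ssimplex M k) x :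
  simplex_density (form_sub w1 w2) s x = simplex_density w1 s x - simplex_density w2 s x.
Proof. by rewrite /simplex_density; case: ifP => // _; rewrite subrr. Qed.

Lemma iterated_integral_density_sub w1 w2 (s : ssimplex M k) :
  iterated_integral (fun x => simplex_density w1 s x - simplex_density w2 s x) =
  iterated_integral (simplex_density w1 s) - iterated_integral (simplex_density w2 s).
Proof.
have [B1 b1] := simplex_density_bounded_limit w1 s.
have [B2 b2] := simplex_density_bounded_limit w2 s.
exact: iterated_integralB b1 b2.
Qed.

Lemma integral_sub w1 w2 (c : chains M k) :
  Defs.integral (form_sub w1 w2) c = Defs.integral w1 c - Defs.integral w2 c.
Proof.
apply: (@freeg_additive_ext _ _ (Defs.integral (form_sub w1 w2))
  (Defs.integral w1 \- Defs.integral w2)) => s.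
rewrite [RHS]/= !integralU -iterated_integral_density_sub; congr iterated_integral.
by apply/funext => x; exact: simplex_density_sub.
Qed.

Lemma integral_form0 (c : chains M k) : Defs.integral (form0 M k) c = 0.
Proof.
apply: (@freeg_additive_ext _ _ (Defs.integral (form0 M k)) \0) => s.
rewrite integralU -[RHS](iterated_integral0 k); congr iterated_integral.
by apply/funext => x; rewrite /simplex_density; case: ifP.
Qed.

End Forms.

Lemma simplex_param_continuous {R : realType} (M : manifold R) k (s : ssimplex M k) x :
  open_simplex x -> {for x, continuous (simplex_param s)}.
Proof.
move=> ox; have [U [c [G [oU Ux ac sG GE]]]] := simplex_param_local s (open_simplex_corner ox).
have nE : \forall x' \near x, cinv c (G x') = simplex_param s x'.
  have nU : \forall x' \near x, U x' by exact: open_nbhs_nbhs.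
  apply: filterS2 (open_simplex_near ox) nU => x' ox' Ux'.
  by have [_ ->] := GE x' Ux' (open_simplex_corner ox').
rewrite /prop_for /continuous_at -(nbhs_singleton nE).
apply: cvg_trans (near_eq_cvg nE) _.
have [cG _] := GE x Ux (open_simplex_corner ox).
exact: (@continuous_comp _ _ _ G (cinv c) x (sG 0%N x Ux) (cinv_continuous cG)).
Qed.

(** By the chain rule the tangent vectors of [f \o s] are images under the tangent map of [f], so
    the density only sees the pullback of [w]. *)
Lemma simplex_density_push {R : realType} (M N : manifold R) (f : smap M N) k
    (w : Defs.form N k) (s : ssimplex M k) x : open_simplex x ->
  exists v : 'I_k -> 'rV[R]_(mdim M), simplex_density w (push_simplex f s) x =
    w (f (simplex_param s x)) (fun i => tangent_map f (simplex_param s x) (v i)).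
Proof.
move=> ox; pose p := simplex_param s x; pose c0 := chart_at p.
have [U [c [G [oU Ux ac sG GE]]]] := simplex_param_local s (open_simplex_corner ox).
have nU : \forall x' \near x, U x' by exact: open_nbhs_nbhs.
have nox := open_simplex_near ox.
have [cG pE] := GE x Ux (open_simplex_corner ox).
have nc : \forall x' \near x, cdom c0 (simplex_param s x').
  have nd : nbhs p (cdom c0).
    by apply: open_nbhs_nbhs; split; [exact: cdom_open|exact: chart_at_dom].
  exact: (simplex_param_continuous (s := s) ox nd).
have dG : differentiable G x by have [+ _] := sG 1; exact.
have dcG : differentiable ((c0 \o cinv c) \o G) x.
  apply: differentiable_comp => //; apply: transition_differentiable => //.
    exact: chart_at_atlas.
  by rewrite -pE; exact: chart_at_dom.
exists (fun i => 'D_(delta_mx 0 i) ((c0 \o cinv c) \o G) x).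
rewrite {1}/simplex_density ifT //.
have -> : simplex_param (push_simplex f s) x = f p by [].
congr (w _ _); apply/funext => i; rewrite /tangent_map -/p -/c0.
have c0p : c0 p = c0 (cinv c (G x)) by rewrite -pE.
have dF : differentiable (chart_at (f p) \o f \o cinv c0) (((c0 \o cinv c) \o G) x).
  have [_ /(_ c0 (chart_at (f p)) (chart_at_atlas _) (chart_at_atlas _) 1)[+ _]] := smap_smooth f.
  apply; rewrite /= -c0p; split; first by apply: cmap_cod; exact: chart_at_dom.
  by rewrite cmapK; [exact: chart_at_dom|exact: chart_at_dom].
rewrite (near_eq_derive (g := (chart_at (f p) \o f \o cinv c0) \o ((c0 \o cinv c) \o G))).
  rewrite deriveE; last exact: differentiable_comp.
  by rewrite diff_comp //= -c0p deriveE.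
near=> x' => /=.
have -> : cinv c (G x') = simplex_param s x'.
  have Ux' : U x' by near: x'.
  have ox' : open_simplex x' by near: x'.
  by have [_ ->] := GE x' Ux' (open_simplex_corner ox').
rewrite cmapK //; near: x'; exact: nc.
Unshelve. all: by end_near.
Qed.

Lemma integral_push_eq0 {R : realType} (M N : manifold R) (f : smap M N) k
    (w : Defs.form N k) :
  (forall p v, w (f p) (fun i => tangent_map f p (v i)) = 0) ->
  forall b : chains M k, Defs.integral w (push_chain f k b) = 0.
Proof.
move=> w0; apply: (@freeg_additive_ext _ _ (Defs.integral w \o push_chain f k) \0) => s /=.
rewrite zliftU integralU -[RHS](iterated_integral0 k); congr iterated_integral.
apply/funext => x; have [ox|nox] := boolP (open_simplex x); last exact: simplex_density_out.
by have [v ->] := simplex_density_push f w s ox.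
Qed.

(** * Small affine simplices *)

Section AffineSimplices.
Context {R : realType} {k m : nat}.
Implicit Types (y : 'rV[R]_m) (u : 'I_k -> 'rV[R]_m).

Definition affine_fun y u (x : 'rV[R]_k) : 'rV[R]_m := y + \sum_i x 0 i *: u i.

Lemma affine_fun_smooth y u : smooth_on setT (affine_fun y u).
Proof.
move=> n; apply: CnD; [exact: openT|exact/Cn_cst/openT|].
apply: Cn_sum; first exact: openT.
by move=> i; apply: CnZl; [exact: openT|exact: smooth_on_coord].
Qed.

Lemma affine_fun_derive y u x i : 'D_(delta_mx 0 i) (affine_fun y u) x = u i.
Proof.
rewrite /derive; apply: cvg_lim => //.
apply: (@cvg_trans _ (cst (u i) @ 0^')); last exact: cvg_cst.
apply: near_eq_cvg; near=> h; rewrite /= /affine_fun.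
have h0 : h != 0 by near: h; exact: nbhs_dnbhs_neq.
rewrite opprD addrACA subrr add0r -sumrB (bigD1 i) //= big1 => [|j ji].
  by rewrite addr0 !mxE !eqxx mulr1 -scalerBl addrK scalerA mulVf // scale1r.
by rewrite !mxE (negPf ji) andbF mulr0 add0r subrr.
Unshelve. all: by end_near.
Qed.

Lemma affine_fun_near y (v : 'I_k -> 'rV[R]_m) (P : set 'rV[R]_m) : nbhs y P ->
  exists2 e0 : R, 0 < e0 & forall e, 0 < e <= e0 -> forall x, cube x ->
    P (affine_fun y (fun i => e *: v i) x).
Proof.
move=> /nbhs_ballP[r /= r0 rP]; pose S := \sum_i `|v i|.
have S0 : 0 <= S by exact: sumr_ge0.
(* Over the cube the point moves by at most [e * S]; the summand 1 keeps the denominator positive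
   and the factor 1/2 makes the bound strict. *)
exists (r / (S + 1) / 2); first by rewrite !divr_gt0 // ltr_wpDl.
move=> e /andP[e0 ee0] x cx; apply: rP.
rewrite -ball_normE /= /affine_fun opprD addNKr normrN.
apply: (@le_lt_trans _ _ (e * S)).
  apply: le_trans (ler_norm_sum _ _ _) _; rewrite mulr_sumr; apply: ler_sum => i _.
  rewrite !normrZ (gtr0_norm e0); have /andP[x0 x1] := cx i.
  by rewrite ger0_norm // ler_piMl // mulr_ge0 // ltW.
have S1 : 0 < S + 1 by rewrite ltr_wpDl.
apply: (@le_lt_trans _ _ (r / (S + 1) / 2 * (S + 1))).
  by apply: ler_pM => //; [exact: ltW|rewrite lerDl].
rewrite mulrAC divfK ?gt_eqF //.
by rewrite ltr_pdivrMr // ltr_pMr // ltr1n.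
Qed.

End AffineSimplices.

Section SmallSimplices.
Context {R : realType} {M N : manifold R} (f : smap M N) (k : nat).

(** Dropping entry 0 of the barycentric coordinates inverts [corner] and lands in the cube, where
    the affine map stays inside the chart. *)
Lemma affine_simplex_subproof (c : @chart R M (mdim M)) y (u : 'I_k -> 'rV[R]_(mdim M)) :
  atlas c -> (forall x, cube x -> ccod c (affine_fun y u x)) ->
  smooth_simplex (fun t : stdsimplex R k =>
    cinv c (affine_fun y u (\row_i val t 0 (lift ord0 i)))).
Proof.
move=> ac cc t.
pose T (t : 'rV[R]_k.+1) : 'rV[R]_k := \row_i t 0 (lift ord0 i).
have sT : smooth_on setT T.
  move=> n; apply: Cn_rV; first exact: openT.
  move=> i; apply: (Cn_near openT _ (smooth_on_coord (lift ord0 i) n)) => x _.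
  by rewrite mxE.
have sA : smooth_on setT (affine_fun y u \o T).
  by apply: smooth_on_comp sT (affine_fun_smooth y u) => //; exact: openT.
have cT (t' : stdsimplex R k) : ccod c (affine_fun y u (T (val t'))).
  apply: cc => i; rewrite mxE; have /andP[/forallP t0 /eqP t1] := valP t'.
  by rewrite t0 -t1 (bigD1 (lift ord0 i)) //= lerDl sumr_ge0.
exists setT, c, (affine_fun y u \o T); split=> //; first exact: openT.
by move=> t' _; split; [apply: cinv_dom|apply: cinvK]; exact: cT.
Qed.

Context (w : Defs.form N k) (c : @chart R M (mdim M)) (d : @chart R N (mdim N)).
Context (ac : atlas c) (ad : atlas d).

(** The pullback of [w] along [f], read in the charts [c] and [d]. *)
Definition pullback_chart (y : 'rV[R]_(mdim M)) (v : 'I_k -> 'rV[R]_(mdim M)) : R :=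
  form_chart w d (d (f (cinv c y))) (fun i => 'D_(v i) (d \o f \o cinv c) y).

Definition pullback_dom := [set y | ccod c y /\ cdom d (f (cinv c y))].

Lemma pullback_dom_open : open pullback_dom.
Proof.
have [cf _] := smap_smooth f.
apply: (openIpre (@ccod_open _ _ _ c) (@cdom_open _ _ _ d) (f := f \o cinv c)) => y cy.
exact: continuous_comp (cinv_continuous cy) (cf _).
Qed.

Lemma pullback_chart_continuous y v : pullback_dom y ->
  {for y, continuous (pullback_chart^~ v)}.
Proof.
move=> [cy dy]; have [_ /(_ c d ac ad) sF] := smap_smooth f.
apply: (@form_chart_continuous _ _ _ w d _ y (d \o f \o cinv c)
  (fun i y => 'D_(v i) (d \o f \o cinv c) y)) => //.
- exact: cmap_cod.
- exact: (sF 0%N).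
- by move=> i; have [_ /(_ (v i))] := sF 1; apply.
Qed.

(** The partial derivatives are the edge vectors [e *: v i]; multilinearity extracts one factor [e]
    for each of the [k] slots. *)
Lemma density_affine_simplex y (v : 'I_k -> 'rV[R]_(mdim M)) e (s : ssimplex M k) x :
  (forall x, cube x -> pullback_dom (affine_fun y (fun i => e *: v i) x)) ->
  (forall t : stdsimplex R k, s t =
    cinv c (affine_fun y (fun i => e *: v i) (\row_i val t 0 (lift ord0 i)))) ->
  open_simplex x ->
  simplex_density w (push_simplex f s) x =
    e ^+ k * pullback_chart (affine_fun y (fun i => e *: v i) x) v.
Proof.
move=> cc sE ox; pose A := affine_fun y (fun i => e *: v i).
have [_ /(_ c d ac ad) sF] := smap_smooth f.
have [cA dA] := cc x (open_simplex_cube ox).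
have dAx : differentiable A x by have [+ _] := affine_fun_smooth y (fun i => e *: v i) 1; exact.
have dF : differentiable (d \o f \o cinv c) (A x) by have [+ _] := sF 1; apply.
rewrite (@simplex_density_chart _ _ _ _ _ d ((d \o f \o cinv c) \o A)) //.
- rewrite /pullback_chart -(multilinear_scale (form_chart_multilinear w d _)).
  congr (form_chart _ _ _ _); apply/funext => i.
  rewrite deriveE; last exact: differentiable_comp.
  by rewrite diff_comp //= -(deriveE _ dAx) affine_fun_derive linearZ /= -deriveE.
- exact: differentiable_comp.
- exact: cmap_cod.
apply: filterS (open_simplex_near ox) => x' ox'.
have [cA' dA'] := cc x' (open_simplex_cube ox').
rewrite /= [RHS]cmapK //; congr (f _).
rewrite /simplex_param sE val_insubd (open_simplex_corner ox').
congr (cinv c (affine_fun _ _ _)); apply/rowP => i.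
by rewrite mxE cornerS.
Qed.

End SmallSimplices.

(** With the distinguished charts, [d \o cinv d] is the identity near the point, so the change of
    coordinates inside [form_chart] disappears. *)
Lemma pullback_chart_at {R : realType} {M N : manifold R} (f : smap M N) k
    (w : Defs.form N k) (p : M) v :
  pullback_chart f w (chart_at p) (chart_at (f p)) (chart_at p p) v =
  w (f p) (fun i => tangent_map f p (v i)).
Proof.
set c := chart_at p; set d := chart_at (f p).
have cp : cinv c (c p) = p by rewrite cmapK //; exact: chart_at_dom.
have dfp : cinv d (d (f p)) = f p by rewrite cmapK //; exact: chart_at_dom.
have dd : ccod d (d (f p)) by apply: cmap_cod; exact: chart_at_dom.
have d_id u : 'd (d \o cinv d) (d (f p)) u = u.
  rewrite -deriveE; last first.
    apply: transition_differentiable => //; try exact: chart_at_atlas.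
    by rewrite dfp; exact: chart_at_dom.
  transitivity ('D_u id (d (f p))); last exact: derive_id.
  apply: near_eq_derive.
  have nd : \forall y \near d (f p), ccod d y by apply: open_nbhs_nbhs; split; [exact: ccod_open|].
  by apply: filterS nd => y dy; rewrite /= cinvK.
have dF : differentiable (d \o f \o cinv c) (c p).
  have [_ /(_ c d (chart_at_atlas _) (chart_at_atlas _) 1)[+ _]] := smap_smooth f.
  apply; split; first by apply: cmap_cod; exact: chart_at_dom.
  by rewrite cp; exact: chart_at_dom.
rewrite /pullback_chart /form_chart cp dfp; congr (w _ _); apply/funext => i.
by rewrite -/d d_id deriveE.
Qed.

(* If the values differed, the difference of the integrals over a small affine simplex
   of size [e] would be of order [e ^+ k], hence strictly between 0 and 1. *)
Lemma pullback_form_le {R : realType} {M N : manifold R} (f : smap M N) k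
    (w1 w2 : Defs.form N k) (p : M) v : (0 < k)%N ->
  (forall s : ssimplex M k, exists m : int, Defs.integral w1 << push_simplex f s >> -
     Defs.integral w2 << push_simplex f s >> = m%:~R) ->
  w1 (f p) (fun i => tangent_map f p (v i)) <= w2 (f p) (fun i => tangent_map f p (v i)).
Proof.
move=> k0 wZ; rewrite leNgt -!pullback_chart_at -subr_gt0.
set c := chart_at p; set d := chart_at (f p).
have [ac ad] : atlas c /\ atlas d by split; exact: chart_at_atlas.
pose g y := pullback_chart f w1 c d y v - pullback_chart f w2 c d y v.
rewrite -/(g (c p)); apply/negP => g0; set r := g (c p) in g0.
have domp : pullback_dom f c d (c p).
  split; first by apply: cmap_cod; exact: chart_at_dom.
  by rewrite cmapK; [exact: chart_at_dom|exact: chart_at_dom].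
have cg : {for c p, continuous g}.
  by apply: continuousB; exact: pullback_chart_continuous.
have nP : \forall y \near c p, pullback_dom f c d y /\ r / 2 <= g y <= r * 2.
  have nd : \forall y \near c p, pullback_dom f c d y.
    by apply: open_nbhs_nbhs; split=> //; exact: pullback_dom_open.
  have r1 : r / 2 < r by rewrite ltr_pdivrMr // ltr_pMr // ltr1n.
  have r2 : r < r * 2 by rewrite ltr_pMr // ltr1n.
  apply: filterS3 nd (cvgr_ge _ cg _ r1) (cvgr_le _ cg _ r2) => y dy h1 h2.
  by split=> //; rewrite h1.
have [e0 e00 e0P] := affine_fun_near v nP.
(* The first bound keeps the simplex where [g] lies between [r / 2] and [r * 2]. The second gives
   [e <= 1], hence [e ^+ k <= e] as [k > 0], and makes [e ^+ k * (r * 2)] less than 1. *)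
pose e := Num.min e0 (r * 2 + 1)^-1.
have r21 : 0 < r * 2 + 1 by rewrite addr_gt0 // mulr_gt0.
have e_gt0 : 0 < e by rewrite lt_min e00 invr_gt0.
have e_ok : 0 < e <= e0 by rewrite e_gt0 ge_min lexx.
have ePx := e0P e e_ok.
have cc x : cube x -> pullback_dom f c d (affine_fun (c p) (fun i => e *: v i) x).
  by move=> /ePx[].
pose s := SSimplex (affine_simplex_subproof ac (fun x cx => (cc x cx).1)).
have sE t : s t =
    cinv c (affine_fun (c p) (fun i => e *: v i) (\row_i val t 0 (lift ord0 i))) by [].
pose D := simplex_density (form_sub w1 w2) (push_simplex f s).
have DE x : open_simplex x -> D x = e ^+ k * g (affine_fun (c p) (fun i => e *: v i) x).
  move=> ox; rewrite /D simplex_density_sub.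
  by rewrite !(density_affine_simplex _ ac ad cc sE ox) mulrBr.
have D0 x : ~~ open_simplex x -> D x = 0 by exact: simplex_density_out.
have [B bD] : exists B, bounded_limit B D by exact: simplex_density_bounded_limit.
have ek : 0 < e ^+ k by rewrite exprn_gt0.
have gP x : open_simplex x -> r / 2 <= g (affine_fun (c p) (fun i => e *: v i) x) <= r * 2.
  by move=> /open_simplex_cube /ePx[].
have r20 : 0 < r / 2 by rewrite divr_gt0.
have D_ge0 x : 0 <= D x.
  have [ox|/D0 ->//] := boolP (open_simplex x); rewrite DE //.
  by have /andP[h _] := gP x ox; rewrite mulr_ge0 // ?(ltW ek) // (le_trans (ltW r20)).
have I1 : iterated_integral D < 1.
  apply: (@le_lt_trans _ _ (e ^+ k * (r * 2))).
    apply: (iterated_integral_le bD) => x.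
    have [ox|/D0 ->] := boolP (open_simplex x); last by rewrite !mulr_ge0 ?(ltW ek) ?(ltW g0).
    by rewrite DE // ler_pM2l //; case/andP: (gP x ox).
  have e1 : e <= (r * 2 + 1)^-1 by rewrite ge_min lexx orbT.
  have e1' : e <= 1.
    by rewrite (le_trans e1) // invf_le1 // lerDr mulr_ge0 // ltW.
  apply: (@le_lt_trans _ _ ((r * 2 + 1)^-1 * (r * 2))).
    rewrite ler_pM2r ?mulr_gt0 // (le_trans _ e1) // -{2}[e]expr1.
    by apply: ler_wiXn2l => //; exact: ltW.
  by rewrite mulrC ltr_pdivrMr // mul1r ltrDl.
(* The cube with side [1 / (k + 1)] lies in the open simplex: its [k] coordinates sum to at most
   [k / (k + 1)]. *)
have a0 : 0 < (k.+1%:R^-1 : R) by rewrite invr_gt0.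
have I0 : 0 < iterated_integral D.
  have m0 : 0 < e ^+ k * (r / 2) by rewrite mulr_gt0.
  apply: lt_le_trans (iterated_integral_ge bD (ltW m0) a0 D_ge0 _).
    by rewrite mulr_gt0 // exprn_gt0.
  move=> x xa; have ox : open_simplex x.
    apply/andP; split; first by apply/forallP => i; case/andP: (xa i).
    apply: (@le_lt_trans _ _ (\sum_(i < k) k.+1%:R^-1)).
      by apply: ler_sum => i _; rewrite ltW //; case/andP: (xa i).
    by rewrite sumr_const card_ord -[X in X < _]mulr_natl ltr_pdivrMr // mul1r ltr_nat.
  by rewrite DE // ler_pM2l //; case/andP: (gP x ox).
have [m] := wZ s; rewrite -integral_sub integralU -/D => Dm.
by move: I0 I1; rewrite Dm ltr0z ltrz1 => h1 h2; lia.
Qed.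

Lemma pullback_form_eq {R : realType} {M N : manifold R} (f : smap M N) k
    (w1 w2 : Defs.form N k) : (0 < k)%N ->
  (forall s : ssimplex M k, exp2pii (Defs.integral w1 << push_simplex f s >>) =
     exp2pii (Defs.integral w2 << push_simplex f s >>)) ->
  forall p v, w1 (f p) (fun i => tangent_map f p (v i)) =
    w2 (f p) (fun i => tangent_map f p (v i)).
Proof.
move=> k0 w12 p v; apply/eqP; rewrite eq_le.
by rewrite !pullback_form_le // => s; exact: exp2pii_eq.
Qed.

(** * Forms with equal integrals modulo integers *)

Section IdentityMap.
Context {R : realType} (M : manifold R).

Lemma id_smooth : smooth_map (id : M -> M).
Proof.
split; first by move=> x; exact: cvg_id.
by move=> c d ac ad; exact: atlas_smooth.
Qed.

Definition id_smap : smap M M := Smap id_smooth.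

Lemma tangent_map_id (p : M) v : tangent_map id_smap p v = v.
Proof.
have cp : cinv (chart_at p) (chart_at p p) = p by rewrite cmapK //; exact: chart_at_dom.
rewrite /tangent_map /= -deriveE; last first.
  apply: (@transition_differentiable _ _ (chart_at p) (chart_at p)); try exact: chart_at_atlas.
    by apply: cmap_cod; exact: chart_at_dom.
  by rewrite cp; exact: chart_at_dom.
transitivity ('D_v id (chart_at p p)); last exact: derive_id.
apply: near_eq_derive.
have nd : \forall y \near chart_at p p, ccod (chart_at p) y.
  apply: open_nbhs_nbhs; split; first exact: ccod_open.
  by apply: cmap_cod; exact: chart_at_dom.
by apply: filterS nd => y dy; rewrite /= cinvK.
Qed.

(** Along the identity map the tangent vectors are arbitrary, so the pointwise comparison of
    pulled-back forms becomes equality of forms. *)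
Lemma form_eq_mod_int k (w1 w2 : Defs.form M k) : (0 < k)%N ->
  (forall s : ssimplex M k, exp2pii (Defs.integral w1 << s >>) =
     exp2pii (Defs.integral w2 << s >>)) -> w1 = w2.
Proof.
move=> k0 w12; apply: form_ext => p v.
have pushE (s : ssimplex M k) : push_simplex id_smap s = s by exact: ssimplex_ext.
have := @pullback_form_eq _ _ _ id_smap k w1 w2 k0 _ p v.
have -> : (fun i => tangent_map id_smap p (v i)) = v.
  by apply/funext => i; exact: tangent_map_id.
by apply=> s; rewrite pushE.
Qed.

End IdentityMap.

(** * From cone characters to relative characters *)

(** A left inverse sends a simplex in the image to its only preimage and every other simplex to
    0. *)
Lemma push_chain_inj {R : realType} (A X : manifold R) (f : smap A X) k :
  injective f -> injective (push_chain f k).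
Proof.
move=> f_inj.
have s_inj (s t : ssimplex A k) : push_simplex f s = push_simplex f t -> s = t.
  move=> st; apply: ssimplex_ext => x; apply: f_inj.
  exact: (congr1 (fun u : ssimplex X k => u x) st).
pose r (s' : ssimplex X k) : {freeg (ssimplex A k) / int} :=
  if pselect (exists s, push_simplex f s = s') is left e then << projT1 (cid e) >> else 0.
have rK : cancel (push_chain f k) (zlift r).
  apply: (@freeg_additive_ext _ _ (zlift r \o push_chain f k) idfun) => s /=.
  rewrite zliftU zliftU /r; case: pselect => [e|ne]; last by case: ne; exists s.
  by case: cid => t /= /s_inj ->.
exact: can_inj rK.
Qed.

(** The push-forward of the boundary of [t] is the double boundary of [s], hence 0, and push-forward
    is injective. In degree 0 the boundary is 0 by definition. *)
Lemma shift_bd_eq0 {R : realType} (A X : manifold R) (f : smap A X) k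
    (s : chains X k.+1) (t : chains A k) : injective f ->
  sing_bd X k.+1 s = push_chain f k t -> shift_bd (singular A) k.+1 t = 0.
Proof.
move=> f_inj; case: k s t => [//|k] s t st.
apply: (push_chain_inj f_inj); rewrite raddf0.
change (push_chain f k (sing_bd A k.+1 t) = 0).
by rewrite (push_chain_bd f (k := k.+1)) -st (sing_bdK (k := k.+2)).
Qed.

Section ConeToRelative.
Context {R : realType} {A X : manifold R} (f : smap A X) (k : nat).

Local Notation cone := (cone (push f)).
Local Notation rel := (relative (push f)).
Local Notation q := (@Defs.cycle_map _ _ (cone_to_rel (push f)) k.+1).

Lemma cycle_map_bd (x : cone k.+2) : q (bd_cycle x) = bd_cycle (cone_to_rel_fun x : rel k.+2).
Proof. by apply: val_inj; exact: (@cone_to_rel_bd _ _ (push f) k.+2 x). Qed.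

(** A representative [s] of a relative cycle has boundary the push-forward of some [t]; the sign
    convention of the cone makes [(s, - t)] a cycle over it. *)
Lemma cycle_map_surj (z : Defs.cycle rel k.+1) : injective f -> exists z', q z' = z.
Proof.
move=> f_inj; pose s := repr (val z : rel_ch (push f) k.+1).
have [t tE] : exists t, sing_bd X k.+1 s = push_chain f k t.
  apply/(@rel_class_eq0 _ _ (push f)).
  have := rel_bd_class (push f) (k := k.+1) s; rewrite rel_class_repr => <-.
  by case: (z) => y /= /eqP.
have t0 := shift_bd_eq0 f_inj tE.
have zc : ((s, - t) : cone k.+1) \in is_cycle (k := k.+1).
  apply/eqP; congr (_, _).
    change (sing_bd X k.+1 s + push_chain f k (- t) = 0).
    by rewrite tE raddfN subrr.
  by rewrite raddfN t0 !oppr0.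
by exists (Cycle zc); apply: val_inj; exact: rel_class_repr.
Qed.

(** If [s] is the push-forward of [b], the cycle condition on [(s, t)] says that [t] plus the
    boundary of [b] pushes forward to 0; injectivity gives [t = - sing_bd A k.+1 b]. *)
Lemma cycle_map_ker (z : Defs.cycle cone k.+1) : injective f -> q z = 0 ->
  exists b : chains A k.+1, z = bd_cycle ((0, b) : cone k.+2).
Proof.
move=> f_inj qz.
have /(@rel_class_eq0 _ _ (push f))[b bE] : rel_class (push f) k.+1 (val z).1 = 0.
  exact: (congr1 val qz).
exists b; apply: val_inj => /=.
case: z {qz} bE => -[s t] zc bE.
have sE : s = push_chain f k.+1 b := bE.
have zc1 : sing_bd X k.+1 s + push_chain f k t = 0 by have /eqP[] := zc.
rewrite /=; congr (_, _).
  rewrite sE; change (push_chain f k.+1 b = sing_bd X k.+2 0 + push_chain f k.+1 b).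
  by rewrite raddf0 add0r.
change (t = - sing_bd A k.+1 b).
apply: (push_chain_inj f_inj); apply/eqP; rewrite raddfN -addr_eq0; apply/eqP.
by rewrite (push_chain_bd f (k := k.+1)) -sE addrC.
Qed.

End ConeToRelative.

(** * Compatibility with curvature, characteristic class and inclusion of cohomology *)

Section Correspondence.
Context {R : realType} {A X : manifold R} (f : smap A X) (k : nat).

Local Notation cone := (cone (push f)).
Local Notation rel := (relative (push f)).
Local Notation relint := (@rel_integral R A X f k.+2).
Local Notation rcl := (rel_class (push f) k.+2).

Lemma cone_integral_sub (w w' : Defs.form X k.+2 * Defs.form A k.+1) (x : cone k.+2) :
  cone_integral (form_sub w.1 w'.1, form_sub w.2 w'.2) x =
  cone_integral w x - cone_integral w' x.
Proof.
change (Defs.integral (form_sub w.1 w'.1) x.1 + Defs.integral (form_sub w.2 w'.2) x.2 =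
  Defs.integral w.1 x.1 + Defs.integral w.2 x.2 -
  (Defs.integral w'.1 x.1 + Defs.integral w'.2 x.2)).
rewrite (integral_sub w.1 w'.1) (integral_sub w.2 w'.2).
by rewrite opprD addrACA.
Qed.

Lemma cone_integral_cov0 (w : Defs.form X k.+2) (x : cone k.+2) :
  cone_integral (w, form0 A k.+1) x = Defs.integral w x.1.
Proof.
change (Defs.integral w x.1 + Defs.integral (form0 A k.+1) x.2 = Defs.integral w x.1).
by rewrite integral_form0 addr0.
Qed.

Lemma cone_integral_fst (w : Defs.form X k.+2 * Defs.form A k.+1) (c : chains X k.+2) :
  cone_integral w ((c, 0) : cone k.+2) = Defs.integral w.1 c.
Proof.
exact: etrans (congr1 (fun r => Defs.integral w.1 c + r) (raddf0 (Defs.integral w.2)))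
  (addr0 _).
Qed.

Lemma cone_integral_snd (w : Defs.form X k.+2 * Defs.form A k.+1) (c : chains A k.+1) :
  cone_integral w ((0, c) : cone k.+2) = Defs.integral w.2 c.
Proof.
exact: etrans (congr1 (fun r => r + Defs.integral w.2 c) (raddf0 (Defs.integral w.1)))
  (add0r _).
Qed.

(** Chains concentrated in one factor of the cone separate the two forms. Both have positive degree,
    the covariant derivative because the character has degree at least 2. *)
Lemma is_curv_cov_unique (h : char_hom cone k.+2) w w' :
  is_curv_cov h w -> is_curv_cov h w' -> w = w'.
Proof.
move=> hw hw'; have E (x : cone k.+2) : exp2pii (cone_integral w x) = exp2pii (cone_integral w' x).
  by rewrite -hw hw'.
case: w w' E {hw hw'} => [w1 w2] [w1' w2'] E.
have E1 s : exp2pii (Defs.integral w1 << s >>) = exp2pii (Defs.integral w1' << s >>).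
  by have := E ((<< s >>, 0) : cone k.+2); rewrite !cone_integral_fst.
have E2 s : exp2pii (Defs.integral w2 << s >>) = exp2pii (Defs.integral w2' << s >>).
  by have := E ((0, << s >>) : cone k.+2); rewrite !cone_integral_snd.
by rewrite (form_eq_mod_int (ltn0Sn _) E1) (form_eq_mod_int (ltn0Sn _) E2).
Qed.

Lemma curv_covE (h : char_hom cone k.+2) w : is_curv_cov h w -> curv_cov h = w.
Proof.
move=> hw; rewrite /curv_cov; case: xgetP => [w' _ hw'|/(_ w)//].
exact: is_curv_cov_unique hw' hw.
Qed.

Lemma is_curv_cov0 : is_curv_cov (0 : char_hom cone k.+2) (form0 X k.+2, form0 A k.+1).
Proof. by move=> x; rewrite cone_integral_cov0 integral_form0 exp2pii0. Qed.

Lemma is_curv_covB (h h' : char_hom cone k.+2) w w' :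
  is_curv_cov h w -> is_curv_cov h' w' ->
  is_curv_cov (h - h') (form_sub w.1 w'.1, form_sub w.2 w'.2).
Proof. by move=> hw hw' x; rewrite cone_integral_sub exp2piiB -hw -hw'. Qed.

Lemma is_curv_cov_pullback (h : char_hom rel k.+2) w :
  is_rel_curv h w -> is_curv_cov (char_pullback h) (w, form0 A k.+1).
Proof.
move=> [_ hw] x; rewrite cone_integral_cov0 -hw.
by congr (h _); exact: cycle_map_bd.
Qed.

Lemma rel_curvP (h : char_hom rel k.+2) : rel_char f k.+2 h -> is_rel_curv h (rel_curv h).
Proof.
by move=> [w hw]; rewrite /rel_curv; case: xgetP => [w' _ //|/(_ w)].
Qed.

(** [rel_integral] uses an arbitrary representative; the first clause of [is_rel_curv] makes the
    choice immaterial. *)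
Lemma rel_integral_class (w : Defs.form X k.+2) (h : char_hom rel k.+2) c :
  is_rel_curv h w -> relint w (rcl c) = Defs.integral w c.
Proof. by move=> [wE _]; apply: wE; rewrite rel_class_repr. Qed.

Lemma cone_curv_pullback (h : char_hom rel k.+2) : rel_char f k.+2 h ->
  curv_cov (char_pullback h) = (rel_curv h, form0 A k.+1).
Proof. by move=> /rel_curvP hw; apply: curv_covE; exact: is_curv_cov_pullback. Qed.

Lemma cohomology_class0 (C : chain_complex) (G : zmodType) l :
  cohomology_class (0 : cocycle C G l) = 0.
Proof. exact: (raddf0 (\pi_(cohomology C G l)%qT)). Qed.

(** A lift of [h] composed with [q] lifts the pullback, so a cocycle representing the class of [h]
    pulls back to one for the pullback. The remaining case, where integration of [w] is not a
    cocycle, compares default values. *)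
Lemma char_class_pullback (h : char_hom rel k.+2) : rel_char f k.+2 h ->
  cone_char_class (char_pullback h) = class_pullback (rel_char_class h).
Proof.
move=> hh; have hw := rel_curvP hh; rewrite /cone_char_class cone_curv_pullback //.
rewrite /rel_char_class; set w := rel_curv h in hw *.
have wB : zmod_morphism (relint w : rel k.+2 -> R).
  move=> x y; rewrite -[x]rel_class_repr -[y]rel_class_repr -raddfB.
  by rewrite !(rel_integral_class _ hw) raddfB.
have [w0|nw0] := pselect (forall y : rel k.+3, relint w (bd k.+3 y) = 0).
  have [|x|//|mu hmu] := @char_cocycle_exists _ rel k.+2 h (hom_of wB).
  - exact: rel_class_liftable.
  - by rewrite -[x]rel_class_repr (hw.2 _) /= (rel_integral_class _ hw).
  rewrite (char_classE _ hmu); last exact: rel_class_liftable.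
  rewrite /class_pullback cohomology_map_class.
  apply: char_classE; first exact: cone_liftable.
  have [ht [htE muE]] := hmu; exists (hom_comp ht (cm (cone_to_rel (push f)) k.+1)).
  split=> [z|x]; first by rewrite [LHS]htE.
  rewrite [LHS]muE /= cone_integral_cov0; congr (_ - ht _).
    exact: rel_integral_class hw.
  by symmetry; exact: cone_to_rel_bd.
(* On boundaries the term in [ht] vanishes, so an integral cocycle would force the integral of [w]
   to vanish there too. *)
have rel0 : char_class h (relint w) = 0.
  rewrite /char_class; apply: xgetPN => _ [mu [ht [_ muE]] _]; apply: nw0 => y.
  have := muE (bd k.+3 y); have /is_cocycleP -> := valP mu.
  by rewrite (bdK (k := k.+3)) (raddf0 ht) subr0.
have cone0 : char_class (char_pullback h) (cone_integral (w, form0 A k.+1)) = 0.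
  rewrite /char_class; apply: xgetPN => _ [mu [ht [_ muE]] _]; apply: nw0 => y.
  rewrite -[y]rel_class_repr; set s := repr _.
  (* The failure is carried to the cone by lifting a relative chain to [(s, 0)], whose boundary has
     first component the boundary of [s]. *)
  pose x : cone k.+3 := (s, 0).
  have := muE (bd k.+3 x); have /is_cocycleP -> := valP mu.
  rewrite (bdK (k := k.+3)) (raddf0 ht) subr0 cone_integral_cov0.
  have -> : (bd k.+3 x).1 = sing_bd X k.+3 s.
    by change (sing_bd X k.+3 s + push_chain f k.+2 0 = sing_bd X k.+3 s); rewrite raddf0 addr0.
  move=> /esym s0; have -> : bd k.+3 (rel_class (push f) k.+3 s : rel k.+3) =
      rcl (sing_bd X k.+3 s) by exact: rel_bd_class.
  by rewrite (rel_integral_class _ hw).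
(* [class_pullback] is a bare function on classes, so the default values are matched through the
   zero cocycles. *)
rewrite rel0 cone0 -(@cohomology_class0 rel int k.+2) -(@cohomology_class0 cone int k.+2).
rewrite /class_pullback cohomology_map_class; congr cohomology_class.
by apply: val_inj; exact: additive_ext.
Qed.

Lemma coh_incl_pullback (u : cohomology rel (U1 R) k.+1) :
  char_pullback (k := k.+2) (coh_incl (k := k.+2) u) =
  coh_incl (k := k.+2) (class_pullback u).
Proof.
have [mu <-] : exists mu, cohomology_class mu = u by exists (repr u); exact: reprK.
rewrite /class_pullback cohomology_map_class; apply: additive_ext => z.
by rewrite (coh_incl_class (k := k.+2)) [LHS](coh_incl_class (k := k.+2)).
Qed.

End Correspondence.

(** * Bijection onto the parallel characters *)

Section Bijection.
Context {R : realType} {A X : manifold R} (f : smap A X) (k : nat).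

Local Notation cone := (cone (push f)).
Local Notation rel := (relative (push f)).
Local Notation q := (@Defs.cycle_map _ _ (cone_to_rel (push f)) k.+1).

Lemma rel_char_subgroup : is_subgroup (rel_char f k.+2).
Proof.
split; first by exists (form0 X k.+2); split=> [c c' _|c]; rewrite !integral_form0 // exp2pii0.
move=> h h' [w [wE hw]] [w' [wE' hw']]; exists (form_sub w w'); split=> [c c' cc|c].
  apply: etrans (integral_sub w w' c) (etrans _ (esym (integral_sub w w' c'))).
  exact: (congr2 (fun a b => a - b) (wE _ _ cc) (wE' _ _ cc)).
apply: etrans _ (congr1 _ (esym (integral_sub w w' c))).
exact: etrans (congr2 (fun a b => a - b) (hw c) (hw' c)) (esym (exp2piiB _ _)).
Qed.

Lemma cone_char_subgroup : is_subgroup (cone_char f k.+2).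
Proof.
split; first by exists (form0 X k.+2, form0 A k.+1); exact: is_curv_cov0.
move=> h h' [w hw] [w' hw']; eexists; exact: is_curv_covB hw hw'.
Qed.

(** Uniqueness of the pair turns the condition on the chosen [curv_cov] into an existential one. *)
Lemma parallel_charP (h : char_hom cone k.+2) :
  parallel_char f k.+2 h <-> exists w, is_curv_cov h (w, form0 A k.+1).
Proof.
split=> [[[[w th] hw]]|[w hw]]; last first.
  by split; [exists (w, form0 A k.+1)|rewrite /cone_cov (curv_covE hw)].
by rewrite /cone_cov (curv_covE hw) /= => th0; exists w; rewrite -th0.
Qed.

Lemma parallel_char_subgroup : is_subgroup (parallel_char f k.+2).
Proof.
split; first by apply/parallel_charP; exists (form0 X k.+2); exact: is_curv_cov0.
move=> h h' /parallel_charP[w hw] /parallel_charP[w' hw']; apply/parallel_charP.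
exists (form_sub w w').
have -> : form0 A k.+1 = form_sub (form0 A k.+1) (form0 A k.+1).
  by apply: form_ext => p v; rewrite /= subrr.
exact: is_curv_covB hw hw'.
Qed.

Lemma parallel_char_ker (h : char_hom cone k.+2) w z : injective f ->
  is_curv_cov h (w, form0 A k.+1) -> q z = 0 -> h z = 0.
Proof.
move=> f_inj hw qz; have [b ->] := cycle_map_ker f_inj qz.
rewrite (hw _) cone_integral_cov0 -[RHS](@exp2pii0 R); congr exp2pii.
exact: raddf0.
Qed.

(** For a simplex [s] of [A], the boundary of its push-forward, seen in the cone, is killed by [q],
    so the integral of [w] over the push-forward is an integer. Comparison with the zero form on
    small simplices makes the pullback of [w] vanish pointwise. *)
Lemma parallel_curv_push (h : char_hom cone k.+2) w : injective f ->
  is_curv_cov h (w, form0 A k.+1) ->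
  forall b : chains A k.+2, Defs.integral w (push_chain f k.+2 b) = 0.
Proof.
move=> f_inj hw.
have ws s : exp2pii (Defs.integral w << push_simplex f s >>) = 0.
  pose x : cone k.+2 := (<< push_simplex f s >>, 0).
  have qx : q (bd_cycle x) = 0.
    rewrite cycle_map_bd; apply: val_inj; rewrite /=.
    have -> : cone_to_rel_fun x = 0 :> rel k.+2.
      apply/rel_class_eq0; exists << s >>; symmetry; exact: zliftU.
    exact: (raddf0 (@bd rel k.+2)).
  apply: etrans (parallel_char_ker f_inj hw qx).
  exact: etrans (congr1 _ (esym (cone_integral_cov0 w x))) (esym (hw x)).
apply: integral_push_eq0 => p v.
apply: (@pullback_form_eq _ _ _ f k.+2 w (form0 X k.+2) (ltn0Sn _)) => s.
apply: etrans (ws s) _; symmetry.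
exact: etrans (congr1 _ (integral_form0 _)) exp2pii0.
Qed.

Lemma char_pullback_inj : injective f -> injective (@char_pullback R A X f k.+2).
Proof.
move=> f_inj h h' hh'; apply: additive_ext => z.
have [z' <-] := cycle_map_surj z f_inj.
exact: (congr1 (fun g : char_hom cone k.+2 => g z') hh').
Qed.

(** A parallel character is constant on the fibres of [q], so evaluating it on arbitrary preimages
    [l z] defines a homomorphism on relative cycles; its curvature is [w]. *)
Lemma char_pullback_surj (h : char_hom cone k.+2) w : injective f ->
  is_curv_cov h (w, form0 A k.+1) -> exists2 h', rel_char f k.+2 h' & char_pullback h' = h.
Proof.
move=> f_inj hw.
pose l (z : Defs.cycle rel k.+1) := projT1 (cid (cycle_map_surj z f_inj)).
have lE z : q (l z) = z by rewrite /l; case: cid.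
have hE (z z' : Defs.cycle cone k.+1) : q z = q z' -> h z = h z'.
  move=> zz'; have qd : q (z - z') = 0.
    by apply: etrans (cycle_map_zmod_morphism _ z z') _; rewrite zz' subrr.
  by apply/subr0_eq; rewrite -raddfB; exact: (parallel_char_ker f_inj hw qd).
have hB : zmod_morphism (h \o l).
  move=> x y /=; rewrite -raddfB; apply: hE; rewrite lE.
  by apply: etrans (esym (cycle_map_zmod_morphism _ _ _)); rewrite !lE.
exists (hom_of hB : char_hom rel k.+2); last first.
  by apply: additive_ext => z /=; apply: hE; exact: lE.
exists w; split=> [c c'|c].
  (* Two representatives differ by a pushed-forward chain, over which the integral of [w] is exactly
     0. *)
  move=> cc'; have /rel_class_eq0[b bE] : rel_class (push f) k.+2 (c - c') = 0.
    by rewrite raddfB cc' subrr.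
  by apply/subr0_eq; rewrite -raddfB bE; exact: (parallel_curv_push f_inj hw b).
apply: etrans _ (congr1 _ (cone_integral_fst f (w, form0 A k.+1) c)).
by rewrite -hw /=; apply: hE; rewrite lE cycle_map_bd.
Qed.

End Bijection.

Theorem theorem14 (R : realType) (A X : manifold R) (i : smap A X)
    (hi : embedding i) (k : nat) (hk : (2 <= k)%N) :
  [/\ is_subgroup (rel_char i k) /\ is_subgroup (cone_char i k),
      (forall h : char_hom (relative (push i)) k,
         rel_char i k h -> cone_char i k (char_pullback h)) /\
      (forall h h' : char_hom (relative (push i)) k,
         char_pullback (h + h') = char_pullback h + char_pullback h'),
      (forall h : char_hom (relative (push i)) k, rel_char i k h ->
         cone_curv (char_pullback h) = rel_curv h /\
         cone_char_class (char_pullback h) = class_pullback (rel_char_class h)),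
      (forall u : cohomology (relative (push i)) (U1 R) k.-1,
         char_pullback (coh_incl u) = coh_incl (class_pullback u)) &
      is_subgroup (parallel_char i k) /\
      set_bij (rel_char i k) (parallel_char i k) char_pullback].
Proof.
have [i_inj _ _] := hi; case: k hk => [//|[//|l]] _; split.
- by split; [exact: rel_char_subgroup|exact: cone_char_subgroup].
- split=> [h [w hw]|h h']; last by apply: additive_ext.
  by exists (w, form0 A l.+1); exact: is_curv_cov_pullback.
- move=> h hh; split; last exact: char_class_pullback.
  by rewrite /cone_curv cone_curv_pullback.
- exact: coh_incl_pullback.
split; first exact: parallel_char_subgroup.
split.
- move=> h [w hw]; apply/parallel_charP; exists w; exact: is_curv_cov_pullback.
- by move=> h h' _ _; exact: char_pullback_inj.
move=> h /parallel_charP[w hw].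
by have [h' hh' <-] := char_pullback_surj i_inj hw; exists h'.
Qed.
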